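(* Let $\Lambda=U^\top DU$, where $U$ is a Haar-random orthogonal $d\times d$ matrix and $D$ is a diagonal matrix drawn from some (possibly unknown) distribution, independent of $U$. Let $v_1,v_2(\cdot),\dots,v_K(\cdot)$ be an adaptive deterministic algorithm in the extended oracle model that makes $K$ orthonormal queries, where $K^2<d$. Define recursively $v_1^{\mathsf{alg}}=v_1$ and $v_k^{\mathsf{alg}}=v_k(\{\Lambda^iv_j^{\mathsf{alg}}\}_{H_{k-1}})$ for $2\le k\le K$. Let $z_1,\dots,z_K$ be i.i.d. standard Gaussian vectors in $\mathbb{R}^d$, independent of $\Lambda$. Then from the collection $\{\Lambda^iz_j\}_{H_K}$ (without knowledge of $D$ or $\Lambda$) one can construct (almost surely) unit vectors $\tilde v_1,\dots,\tilde v_K$ and orthogonal matrices $U_1^{\mathsf{sim}},\dots,U_K^{\mathsf{sim}}$, where $\tilde v_k$ and $U_k^{\mathsf{sim}}$ depend only on $\{\Lambda^iz_j\}_{H_{k-1}}$ and $z_k$, such that $$\bigl\{(U_{1:K}^{\mathsf{sim}})^\top\Lambda^i\tilde v_j\bigr\}_{H_K}\ \overset{d}{=}\ \bigl\{\Lambda^iv_j^{\mathsf{alg}}\bigr\}_{H_K},\qquad U_{1:K}^{\mathsf{sim}}:=U_1^{\mathsf{sim}}\cdots U_K^{\mathsf{sim}},$$ where equality in distribution is over the randomness of $\Lambda$ and $z_1,\dots,z_K$. Moreover, $\{\Lambda^i\tilde v_j\}_{H_K}$ is a deterministic function of $\{\Lambda^iz_j\}_{H_K}$.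
   Context: For $k\ge0$, $H_k=\{(i,j)\in\mathbb{Z}^2: i+j\le k+1,\ i\ge0,\ 1\le j\le k\}$ (so $H_0=\emptyset$), and $\{\Lambda^iv_j\}_{H_k}$ denotes the family $\{\Lambda^iv_j\}_{(i,j)\in H_k}$. Extended oracle model: at step $k$ the algorithm chooses $v_k\in\mathbb{R}^d$ and then receives all of $\{\Lambda^iv_j\}_{H_k}$. An adaptive deterministic algorithm making $K$ extended oracle queries is a deterministic vector $v_1$ together with deterministic (measurable) functions $v_2(\cdot),\dots,v_K(\cdot)$, where $v_k(\cdot)$ takes $|H_{k-1}|=\frac{k(k+1)}2-1$ vectors as input; the $k$-th query is $v_k(\{\Lambda^iv_j\}_{H_{k-1}})$. The algorithm makes orthonormal queries if $v_1$ is a unit vector and each $v_k(\cdot)$ outputs a unit vector orthogonal to all of its input vectors. $\overset{d}{=}$ denotes equality in distribution (of the indexed families jointly). *)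

(* Defs.v *)
(* MathComp / MathComp-Analysis. *)
From HB Require Import structures.
From mathcomp Require Import all_boot all_order all_algebra.
From mathcomp Require Import all_classical all_reals all_analysis.
Import Order.TTheory GRing.Theory Num.Theory.
Import numFieldNormedType.Exports.

Set Implicit Arguments.
Unset Strict Implicit.
Unset Printing Implicit Defensive.

Local Open Scope classical_set_scope.
Local Open Scope ring_scope.

(* The sigma-algebra on aT generated by a family of maps f i : aT -> T.  With
   the entries of a matrix, or the values of a finite function, as maps, this
   is the product sigma-algebra; over R it is the Borel one. *)
Definition sigma_coord d (T : measurableType d) (I aT : Type)
    (f : I -> aT -> T) : set (set aT) :=
  <<s \bigcup_i preimage_set_system setT (f i) measurable >>.

Lemma sigma_coord_sigma_algebra d (T : measurableType d) (I aT : Type)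
    (f : I -> aT -> T) : sigma_algebra setT (sigma_coord f).
Proof. exact: smallest_sigma_algebra. Qed.

Definition coord_display : measure_display -> measure_display.
Proof. by []. Qed.

Section matrix_measurable.
Context d (T : measurableType d) (m n : nat).

Let coord (ij : 'I_m * 'I_n) (A : 'M[T]_(m, n)) : T := A ij.1 ij.2.

Let salg := sigma_coord_sigma_algebra coord.

Let salg0 : sigma_coord coord set0.
Proof. by case: salg. Qed.

Let salgC A : sigma_coord coord A -> sigma_coord coord (~` A).
Proof. by case: salg => _ + _ => /[apply]; rewrite setTD. Qed.

Let salgU (F : (set 'M[T]_(m, n))^nat) :
  (forall i, sigma_coord coord (F i)) -> sigma_coord coord (\bigcup_i F i).
Proof. by case: salg => _ _; apply. Qed.

HB.instance Definition _ := @isMeasurable.Build (coord_display d)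
  'M[T]_(m, n) (sigma_coord coord) salg0 salgC salgU.

End matrix_measurable.

HB.instance Definition _ (I : finType) (T : pointedType) :=
  isPointed.Build {ffun I -> T} [ffun=> point].

Section ffun_measurable.
Context d (T : measurableType d) (I : finType).

Let coord (i : I) (f : {ffun I -> T}) : T := f i.

Let salg := sigma_coord_sigma_algebra coord.

Let salg0 : sigma_coord coord set0.
Proof. by case: salg. Qed.

Let salgC A : sigma_coord coord A -> sigma_coord coord (~` A).
Proof. by case: salg => _ + _ => /[apply]; rewrite setTD. Qed.

Let salgU (F : (set {ffun I -> T})^nat) :
  (forall i, sigma_coord coord (F i)) -> sigma_coord coord (\bigcup_i F i).
Proof. by case: salg => _ _; apply. Qed.

HB.instance Definition _ := @isMeasurable.Build (coord_display d)
  {ffun I -> T} (sigma_coord coord) salg0 salgC salgU.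

End ffun_measurable.

Section probability_notions.
Context (d : measure_display) (Om : measurableType d) (R : realType).
Variable P : probability Om R.

Definition eq_in_law d' (T : measurableType d') (X Y : Om -> T) : Prop :=
  forall A : set T, measurable A -> P (X @^-1` A) = P (Y @^-1` A).

Definition independent d1 d2 (T1 : measurableType d1) (T2 : measurableType d2)
    (X : Om -> T1) (Y : Om -> T2) : Prop :=
  forall (A : set T1) (B : set T2), measurable A -> measurable B ->
    P (X @^-1` A `&` Y @^-1` B) = (P (X @^-1` A) * P (Y @^-1` B))%E.

(* Taking some of the A i to be setT gives the product rule over every
   subfamily. *)
Definition mutually_independent d' (T : measurableType d') (n : nat)
    (X : 'I_n -> Om -> T) : Prop :=
  forall A : 'I_n -> set T, (forall i, measurable (A i)) ->
    P (\bigcap_i (X i @^-1` A i)) =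
    (\prod_(i < n) fine (P (X i @^-1` A i)))%:E.

End probability_notions.

Section vectors.
Context (R : realType) (d : nat).
Implicit Types (x y : 'cV[R]_d) (Q : 'M[R]_d).

Definition dotv x y : R := \sum_(i < d) x i 0 * y i 0.

Definition unit_vector x : Prop := dotv x x = 1.

Definition orthogonal_mx Q : Prop := Q^T *m Q = 1%:M.

(* mu is the Haar probability measure of the compact group O(d), regarded as a
   law on d x d matrices carried by O(d). *)
Definition haar_orthogonal (mu : probability 'M[R]_d R) : Prop :=
  mu [set Q | orthogonal_mx Q] = 1%E /\
  forall Q (A : set 'M[R]_d), orthogonal_mx Q -> measurable A ->
    mu ((fun V => Q *m V) @^-1` A) = mu A /\
    mu ((fun V => V *m Q) @^-1` A) = mu A.

(* The coordinates are independent with law N(0, 1). *)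
Definition standard_gaussian (mu : probability 'cV[R]_d R) : Prop :=
  forall A : 'I_d -> set R, (forall i, measurable (A i)) ->
    mu [set x | forall i, A i (x i 0)] =
    (\prod_(i < d) fine (normal_prob (0 : R) 1 (A i)))%:E.

End vectors.

(* The bounds i <= k and j <= k on the ordinals are implied by
   i + j <= k + 1 and 1 <= j <= k. *)
Definition Hidx (k : nat) : finType :=
  {ij : 'I_k.+1 * 'I_k.+1 | (ij.1 + ij.2 <= k.+1)%N && (1 <= ij.2 <= k)%N}.

Section oracle.
Context (R : realType) (d : nat).

(* {L^i x_j}_{H_k}; the vectors x_1, x_2, ... are numbered from 1 and x 0 is
   never read. *)
Definition powers (k : nat) (L : 'M[R]_d) (x : nat -> 'cV[R]_d) :
    {ffun Hidx k -> 'cV[R]_d} :=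
  [ffun p : Hidx k => L ^+ (val p).1 *m x (val p).2].

(* v k is the k-th query function, 1 <= k; as Hidx 0 is empty, v 1 amounts to
   a vector.  The value v 0 is irrelevant. *)
Definition algorithm := forall k : nat, {ffun Hidx k.-1 -> 'cV[R]_d} -> 'cV[R]_d.

Definition measurable_algorithm (K : nat) (v : algorithm) : Prop :=
  forall k, (1 <= k <= K)%N -> measurable_fun setT (v k).

Definition orthonormal_queries (K : nat) (v : algorithm) : Prop :=
  forall k, (1 <= k <= K)%N -> forall F : {ffun Hidx k.-1 -> 'cV[R]_d},
    unit_vector (v k F) /\ forall p : Hidx k.-1, dotv (v k F) (F p) = 0.

Fixpoint first_queries (v : algorithm) (L : 'M[R]_d) (n : nat) :
    nat -> 'cV[R]_d :=
  if n is n'.+1 then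
    fun j => if j == n'.+1 then v n'.+1 (powers n' L (first_queries v L n'))
             else first_queries v L n' j
  else fun=> 0.

Definition alg_query (v : algorithm) (L : 'M[R]_d) (k : nat) : 'cV[R]_d :=
  first_queries v L k k.

Lemma alg_queryE (v : algorithm) (L : 'M[R]_d) (k : nat) :
  alg_query v L k.+1 = v k.+1 (powers k L (alg_query v L)).
Proof.
rewrite /alg_query /= eqxx; congr (v _ _); apply/ffunP => -[[i j] /= Hij].
rewrite !ffunE /=; congr (_ *m _).
have : (j <= k)%N by rewrite -ltnS.
move: (nat_of_ord j) => m {Hij j}; elim: k {i} => [|k IHk] /=.
  by rewrite leqn0 => /eqP->.
by rewrite leq_eqVlt => /predU1P[->//|mk]; rewrite (ltn_eqF mk) IHk.
Qed.

End oracle.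

(* Main.v *)
(* For fixed values zeta of the Gaussian vectors, normalizing the component of
   zeta_k orthogonal to the answers received so far is itself an algorithm w with
   orthonormal queries, and any two such algorithms v and w see the same law up to
   rotation.  Indeed, let U_k be the reflection exchanging the k-th queries of w
   (rotated by U_1 ... U_(k-1)) and of v.  It fixes everything received before,
   so L |-> U_k^T L U_k, performed successively, turns the history of w into the
   history of v; and each such step preserves the law of Lambda, because
   conditionally on a history this law is invariant under conjugation by the
   stabilizer of the history.

   The conditional invariance is proved without disintegration, by induction
   along the history: a Haar matrix U is retracted onto the stabilizer of given
   vectors by composing it with reflections, in an equivariant way, and the
   resulting random elements of the stabilizers are combined by Fubini.

   Almost surely z_k avoids the proper subspace determined by Lambda and the other
   z_j, and then L^i w_j is recovered from the L^i z_j by running Gram-Schmidt on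
   pairs. *)
Require Import Defs.
From HB Require Import structures.
From mathcomp Require Import all_boot all_order all_algebra.
From mathcomp Require Import all_classical all_reals all_analysis.
From mathcomp Require Import measurable_realfun ring zify.
Import Order.TTheory GRing.Theory Num.Theory.
Import numFieldNormedType.Exports.

Set Implicit Arguments.
Unset Strict Implicit.
Unset Printing Implicit Defensive.

Local Open Scope classical_set_scope.
Local Open Scope ring_scope.

(** * Measurability of matrix-valued maps *)

Section coordinate_measurability.
Context d1 (aT : measurableType d1).

(** Stated for any space whose sigma-algebra is generated by coordinates [c], so that it serves
    matrices and finite functions alike. *)
Lemma measurable_fun_sigma_coord d0 (T : measurableType d0) (I : Type)
    d2 (B : measurableType d2) (c : I -> B -> T) (f : aT -> B) :
  @measurable _ B = sigma_coord c ->
  (forall i, measurable_fun setT (c i \o f)) -> measurable_fun setT f.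
Proof.
move=> Bc cf; apply: (@measurability _ _ aT B setT f
  (\bigcup_i preimage_set_system setT (c i) measurable) Bc) => _ [_ [i _ [C mC <-]] <-].
by rewrite setTI; have := cf i measurableT C mC; rewrite !setTI.
Qed.

Lemma measurable_sigma_coord d0 (T : measurableType d0) (I : Type)
    d2 (B : measurableType d2) (c : I -> B -> T) (i : I) :
  @measurable _ B = sigma_coord c -> measurable_fun setT (c i).
Proof.
move=> Bc _ C mC; rewrite Bc; apply: sub_sigma_algebra.
by exists i => //; exists C.
Qed.

Lemma measurable_entry d0 (T : measurableType d0) m n
    (f : aT -> 'M[T]_(m, n)) i j :
  measurable_fun setT f -> measurable_fun setT (fun x => f x i j).
Proof.
move=> mf; have -> : (fun x => f x i j) = (fun A : 'M[T]_(m, n) => A i j) \o f by [].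
apply: measurableT_comp => //.
exact: (@measurable_sigma_coord _ T ('I_m * 'I_n)%type _ 'M[T]_(m, n)
  (fun ij A => A ij.1 ij.2) (i, j)).
Qed.

Lemma measurable_mx d0 (T : measurableType d0) m n
    (f : aT -> 'M[T]_(m, n)) :
  (forall i j, measurable_fun setT (fun x => f x i j)) ->
  measurable_fun setT f.
Proof.
move=> mf; apply: (@measurable_fun_sigma_coord _ T ('I_m * 'I_n)%type _ 'M[T]_(m, n)
  (fun ij A => A ij.1 ij.2)) => //.
by case=> i j; exact: mf.
Qed.

Lemma measurable_ffun_app d0 (T : measurableType d0) (I : finType)
    (f : aT -> {ffun I -> T}) i :
  measurable_fun setT f -> measurable_fun setT (fun x => f x i).
Proof.
move=> mf; have -> : (fun x => f x i) = (fun A : {ffun I -> T} => A i) \o f by [].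
apply: measurableT_comp => //.
exact: (@measurable_sigma_coord _ T I _ {ffun I -> T} (fun i A => A i) i).
Qed.

Lemma measurable_ffun d0 (T : measurableType d0) (I : finType)
    (f : aT -> {ffun I -> T}) :
  (forall i, measurable_fun setT (fun x => f x i)) ->
  measurable_fun setT f.
Proof.
move=> mf; exact: (@measurable_fun_sigma_coord _ T I _ {ffun I -> T}
  (fun i A => A i)).
Qed.

End coordinate_measurability.

Section matrix_operations.
Context d1 (aT : measurableType d1) (R : realType).

Lemma measurable_mulmx m n p (f : aT -> 'M[R]_(m, n)) (g : aT -> 'M[R]_(n, p)) :
  measurable_fun setT f -> measurable_fun setT g ->
  measurable_fun setT (fun x => f x *m g x).
Proof.
move=> mf mg; apply: measurable_mx => i j.
under eq_fun do rewrite mxE.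
apply: measurable_sum => k.
by apply: measurable_funM; exact: measurable_entry.
Qed.

Lemma measurable_addmx m n (f g : aT -> 'M[R]_(m, n)) :
  measurable_fun setT f -> measurable_fun setT g ->
  measurable_fun setT (fun x => f x + g x).
Proof.
move=> mf mg; apply: measurable_mx => i j.
under eq_fun do rewrite mxE.
by apply: measurable_funD; exact: measurable_entry.
Qed.

Lemma measurable_oppmx m n (f : aT -> 'M[R]_(m, n)) :
  measurable_fun setT f -> measurable_fun setT (fun x => - f x).
Proof.
move=> mf; apply: measurable_mx => i j.
under eq_fun do rewrite mxE.
by apply: measurableT_comp => //; exact: measurable_entry.
Qed.

Lemma measurable_submx m n (f g : aT -> 'M[R]_(m, n)) :
  measurable_fun setT f -> measurable_fun setT g ->
  measurable_fun setT (fun x => f x - g x).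
Proof. by move=> mf mg; apply/measurable_addmx/measurable_oppmx. Qed.

Lemma measurable_scalemx m n (c : aT -> R) (f : aT -> 'M[R]_(m, n)) :
  measurable_fun setT c -> measurable_fun setT f ->
  measurable_fun setT (fun x => c x *: f x).
Proof.
move=> mc mf; apply: measurable_mx => i j.
under eq_fun do rewrite mxE.
by apply: measurable_funM => //; exact: measurable_entry.
Qed.

Lemma measurable_trmx m n (f : aT -> 'M[R]_(m, n)) :
  measurable_fun setT f -> measurable_fun setT (fun x => (f x)^T).
Proof.
move=> mf; apply: measurable_mx => i j.
by under eq_fun do rewrite mxE; exact: measurable_entry.
Qed.

Lemma measurable_diag_mx n (f : aT -> 'rV[R]_n) :
  measurable_fun setT f -> measurable_fun setT (fun x => diag_mx (f x)).
Proof.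
move=> mf; apply: measurable_mx => i j.
under eq_fun do rewrite mxE; case: (i == j) => /=.
- by apply: (measurable_entry (n := n)).
- by under eq_fun do rewrite mulr0n; exact: measurable_cst.
Qed.

Lemma measurable_dotv n (f g : aT -> 'cV[R]_n) :
  measurable_fun setT f -> measurable_fun setT g ->
  measurable_fun setT (fun x => dotv (f x) (g x)).
Proof.
move=> mf mg; apply: measurable_sum => k.
by apply: measurable_funM; exact: measurable_entry.
Qed.

Lemma measurable_expmx n k (f : aT -> 'M[R]_n) :
  measurable_fun setT f -> measurable_fun setT (fun x => f x ^+ k).
Proof.
move=> mf; elim: k => [|k IHk].
  by under eq_fun do rewrite expr0; exact: measurable_cst.
have -> : (fun x => f x ^+ k.+1) = (fun x => f x *m f x ^+ k).
  by apply/funext => x; rewrite exprS.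
exact: measurable_mulmx.
Qed.

Lemma measurable_funV (f : aT -> R) :
  measurable_fun setT f -> measurable_fun setT (fun x => (f x)^-1).
Proof.
move=> mf; suff mV : measurable_fun setT (@GRing.inv R).
  exact: (measurableT_comp mV mf).
(* Inversion is discontinuous at 0; it is split into its value there and its continuous restriction
   to the open set of nonzero reals. *)
have -> : @GRing.inv R = fun y => if y == 0 then 0 else y^-1.
  by apply/funext => y; case: eqP => [->|//]; rewrite invr0.
apply: measurable_fun_if => //; first exact: measurable_fun_eqr.
have -> : setT `&` (fun y : R => y == 0) @^-1` [set false] = [set y | y != 0].
  by rewrite setTI; apply/seteqP; split => y /= => [->//|/negbTE].
apply: open_continuous_measurable_fun; first exact: open_neq.
by apply/in_setP => y /= y0; exact: inv_continuous.
Qed.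

Lemma measurable_funsqrt (f : aT -> R) :
  measurable_fun setT f -> measurable_fun setT (fun x => Num.sqrt (f x)).
Proof.
apply: measurableT_comp.
by apply: continuous_measurable_fun; exact: sqrt_continuous.
Qed.

End matrix_operations.

(** * Reflections and stabilizers *)

Section orthogonal_matrices.
Context (R : realType) (d : nat).
Implicit Types (x y a b c : 'cV[R]_d) (Q S : 'M[R]_d).

Lemma dotvE x y : dotv x y = (x^T *m y) 0 0.
Proof. by rewrite mxE; apply: eq_bigr => i _; rewrite mxE. Qed.

Lemma dotvC x y : dotv x y = dotv y x.
Proof. by apply: eq_bigr => i _; rewrite mulrC. Qed.

Lemma dotvBr a x y : dotv a (x - y) = dotv a x - dotv a y.
Proof. by rewrite !dotvE mulmxBr !mxE. Qed.

Lemma dotvZr a k x : dotv a (k *: x) = k * dotv a x.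
Proof. by rewrite !dotvE -scalemxAr !mxE. Qed.

Lemma dotvBl a x y : dotv (x - y) a = dotv x a - dotv y a.
Proof. by rewrite dotvC dotvBr ![dotv a _]dotvC. Qed.

Lemma dotvZl a k x : dotv (k *: x) a = k * dotv x a.
Proof. by rewrite dotvC dotvZr dotvC. Qed.

Lemma dotv0 x : dotv x 0 = 0.
Proof. by rewrite -(scale0r 0) dotvZr mul0r. Qed.

Lemma dotv_ge0 x : 0 <= dotv x x.
Proof. by apply: sumr_ge0 => i _; rewrite -expr2 sqr_ge0. Qed.

Lemma dotv_eq0 x : (dotv x x == 0) = (x == 0).
Proof.
apply/idP/eqP => [|->]; last by rewrite dotv0.
rewrite psumr_eq0 => [/allP x0|i _]; last by rewrite -expr2 sqr_ge0.
apply/matrixP => i j; rewrite ord1 mxE; apply/eqP.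
by have := x0 i (mem_index_enum i); rewrite /= mulf_eq0 orbb.
Qed.

Lemma orthogonal_mx_dotv Q x y :
  orthogonal_mx Q -> dotv (Q *m x) (Q *m y) = dotv x y.
Proof. by move=> oQ; rewrite !dotvE trmx_mul -mulmxA (mulmxA Q^T) oQ mul1mx. Qed.

Lemma orthogonal_mx1 : orthogonal_mx (1%:M : 'M[R]_d).
Proof. by rewrite /orthogonal_mx trmx1 mul1mx. Qed.

Lemma orthogonal_mxC Q : orthogonal_mx Q -> Q *m Q^T = 1%:M.
Proof. exact: mulmx1C. Qed.

Lemma orthogonal_mx_tr Q : orthogonal_mx Q -> orthogonal_mx Q^T.
Proof. by move=> oQ; rewrite /orthogonal_mx trmxK orthogonal_mxC. Qed.

Lemma orthogonal_mxM Q S :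
  orthogonal_mx Q -> orthogonal_mx S -> orthogonal_mx (Q *m S).
Proof.
move=> oQ oS; rewrite /orthogonal_mx trmx_mul -mulmxA (mulmxA Q^T) oQ mul1mx.
exact: oS.
Qed.

Lemma orthogonal_mxK Q n (A : 'M[R]_(d, n)) :
  orthogonal_mx Q -> Q^T *m (Q *m A) = A.
Proof. by move=> oQ; rewrite mulmxA oQ mul1mx. Qed.

Lemma orthogonal_mxVK Q n (A : 'M[R]_(d, n)) :
  orthogonal_mx Q -> Q *m (Q^T *m A) = A.
Proof. by move=> oQ; rewrite mulmxA orthogonal_mxC// mul1mx. Qed.

Lemma fix_trmx Q x : orthogonal_mx Q -> Q *m x = x -> Q^T *m x = x.
Proof. by move=> oQ Qx; rewrite -{1}Qx orthogonal_mxK. Qed.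

(* As 0^-1 = 0, this is the identity when c = 0. *)
Definition reflection c : 'M[R]_d := 1%:M - (2 / dotv c c) *: (c *m c^T).

Lemma reflectionE c x :
  reflection c *m x = x - (2 * dotv c x / dotv c c) *: c.
Proof.
rewrite mulmxBl mul1mx -scalemxAl -mulmxA; congr (_ - _).
rewrite [c^T *m x]mx11_scalar -dotvE mul_mx_scalar scalerA.
by rewrite mulrAC.
Qed.

Lemma reflection_tr c : (reflection c)^T = reflection c.
Proof.
by rewrite /reflection linearB linearZ /= trmx_mul trmxK trmx1.
Qed.

Lemma reflectionK c x : reflection c *m (reflection c *m x) = x.
Proof.
rewrite !reflectionE dotvBr dotvZr.
have [->|c0] := eqVneq (dotv c c) 0; first by rewrite invr0 !mulr0 scale0r !subr0.
rewrite divfK// -addrA -opprD -scalerDl.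
have -> : 2 * dotv c x / dotv c c + 2 * (dotv c x - 2 * dotv c x) / dotv c c = 0.
  by rewrite -mulrDl -mulrDr [X in 2 * X](_ : _ = 0) ?mulr0 ?mul0r//; ring.
by rewrite scale0r subr0.
Qed.

Lemma orthogonal_reflection c : orthogonal_mx (reflection c).
Proof.
rewrite /orthogonal_mx reflection_tr; apply/matrixP => i j.
have := reflectionK c (delta_mx j 0); rewrite mulmxA => /colP/(_ i).
by rewrite -colE !mxE eqxx andbT => ->; rewrite eq_sym.
Qed.

Lemma reflection_id c x : dotv c x = 0 -> reflection c *m x = x.
Proof. by move=> cx; rewrite reflectionE cx mulr0 mul0r scale0r subr0. Qed.

(** Equal norms give |a - b|^2 = 2 <a - b, a>, so the coefficient of a - b is 1. If a = b the
    reflection is the identity. *)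
Lemma reflection_swap a b : dotv a a = dotv b b -> reflection (a - b) *m a = b.
Proof.
move=> ab; rewrite reflectionE.
have E : dotv (a - b) (a - b) = 2 * dotv (a - b) a.
  by rewrite !(dotvBl, dotvBr) -ab (dotvC a b); ring.
have [c0|c0] := eqVneq (dotv (a - b) (a - b)) 0.
  rewrite c0 invr0 mulr0 scale0r subr0.
  by move/eqP: c0; rewrite dotv_eq0 subr_eq0 => /eqP.
by rewrite -E divff// scale1r opprB addrC subrK.
Qed.

End orthogonal_matrices.

Lemma measurable_reflection d1 (aT : measurableType d1) (R : realType) d
    (c : aT -> 'cV[R]_d) :
  measurable_fun setT c -> measurable_fun setT (fun x => reflection (c x)).
Proof.
move=> mc; apply: measurable_submx; first exact: measurable_cst.
apply: measurable_scalemx.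
  by apply: measurable_funM => //; apply/measurable_funV/measurable_dotv.
by apply: measurable_mulmx => //; exact: measurable_trmx.
Qed.

Definition conjugate (R : realType) d (Q L : 'M[R]_d) := Q^T *m L *m Q.

Lemma conjugateM (R : realType) d (Q S L : 'M[R]_d) :
  conjugate (Q *m S) L = conjugate S (conjugate Q L).
Proof. by rewrite /conjugate trmx_mul !mulmxA. Qed.

Lemma conjugate1 (R : realType) d (L : 'M[R]_d) : conjugate 1%:M L = L.
Proof. by rewrite /conjugate trmx1 mul1mx mulmx1. Qed.

Lemma conjugateX (R : realType) d (Q L : 'M[R]_d) i :
  orthogonal_mx Q -> conjugate Q L ^+ i = conjugate Q (L ^+ i).
Proof.
move=> oQ; elim: i => [|i IHi]; first by rewrite !expr0 /conjugate mulmx1.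
rewrite !exprS IHi /conjugate -!mulmxE -!mulmxA; congr (_ *m (_ *m _)).
by rewrite orthogonal_mxVK.
Qed.

Lemma measurable_conjugate d1 (aT : measurableType d1) (R : realType) d
    (Q L : aT -> 'M[R]_d) :
  measurable_fun setT Q -> measurable_fun setT L ->
  measurable_fun setT (fun x => conjugate (Q x) (L x)).
Proof.
move=> mQ mL; apply: measurable_mulmx => //.
by apply: measurable_mulmx => //; exact: measurable_trmx.
Qed.

Section stabilizer.
Context (R : realType) (d : nat) (I : finType).
Implicit Types (t : {ffun I -> 'cV[R]_d}) (Q S U : 'M[R]_d).

Definition fixes Q t := forall i, Q *m t i = t i.

(* Each reflection restores the image of one vector t i and, the matrix being
   orthogonal, fixes the vectors already restored. *)
Definition stab_retract (s : seq I) t U : 'M[R]_d :=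
  foldr (fun i Q => reflection (Q *m t i - t i) *m Q) U s.

Definition to_stab t U := stab_retract (enum I) t U.

Lemma stab_retractP s t U : orthogonal_mx U ->
  orthogonal_mx (stab_retract s t U) /\
  forall i, i \in s -> stab_retract s t U *m t i = t i.
Proof.
move=> oU; elim: s => [//|i s [oQ Qs]] /=.
split=> [|j]; first exact/orthogonal_mxM/oQ/orthogonal_reflection.
set Q := stab_retract s t U in oQ Qs *.
rewrite inE -mulmxA => /predU1P[->|js].
  by rewrite reflection_swap// orthogonal_mx_dotv.
(* As Q is orthogonal and fixes t j, <Q t_i, t_j> = <Q t_i, Q t_j> = <t_i, t_j>: the new reflection
   vector is orthogonal to t j. *)
rewrite (Qs j)// reflection_id// dotvBl -{1}(Qs _ js) orthogonal_mx_dotv//.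
by rewrite subrr.
Qed.

Lemma orthogonal_to_stab t U : orthogonal_mx U -> orthogonal_mx (to_stab t U).
Proof. by move=> /(stab_retractP (enum I) t)[]. Qed.

Lemma fixes_to_stab t U : orthogonal_mx U -> fixes (to_stab t U) t.
Proof.
by move=> /(stab_retractP (enum I) t)[_ Qt] i; apply: Qt; rewrite mem_enum.
Qed.

(** The reflections depend on the current matrix only through its values on [t], which right
    multiplication by [S] does not change. *)
Lemma to_stabM t U S : fixes S t -> to_stab t (U *m S) = to_stab t U *m S.
Proof.
move=> St; rewrite /to_stab; elim: (enum I) => [//|i s /= ->].
by rewrite -(mulmxA _ S) St mulmxA.
Qed.

Lemma fixesM Q S t : fixes Q t -> fixes S t -> fixes (Q *m S) t.
Proof. by move=> Qt St i; rewrite -mulmxA St Qt. Qed.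

Lemma fixes_tr Q t : orthogonal_mx Q -> fixes Q t -> fixes Q^T t.
Proof. by move=> oQ Qt i; exact: fix_trmx. Qed.

End stabilizer.

Lemma measurable_to_stab d1 (aT : measurableType d1) (R : realType) d
    (I : finType) (t : aT -> {ffun I -> 'cV[R]_d}) (U : aT -> 'M[R]_d) :
  measurable_fun setT t -> measurable_fun setT U ->
  measurable_fun setT (fun x => to_stab (t x) (U x)).
Proof.
move=> mt mU; rewrite /to_stab; elim: (enum I) => [//|i s IHs] /=.
have mti : measurable_fun setT (fun x => t x i) by exact: measurable_ffun_app.
apply: measurable_mulmx => //; apply: measurable_reflection.
by apply: measurable_submx => //; exact: measurable_mulmx.
Qed.

(** * Product laws and independence *)

Section product_sections.
Context d1 d2 (T1 : measurableType d1) (T2 : measurableType d2) (R : realType).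
Variables (P1 : probability T1 R) (P2 : probability T2 R).
Implicit Types E : set (T1 * T2).

Lemma full_setC d (T : measurableType d) (P : probability T R) (X : set T) :
  measurable X -> P X = 1%E -> P.-negligible (~` X).
Proof.
move=> mX PX; apply/negligibleP; first exact: measurableC.
by have := probability_setC P mX; rewrite PX subee.
Qed.

(** The product measure integrates the measures of sections, so only the sections over a set of full
    measure matter. *)
Lemma product_measure_eqx E E' (X : set T1) :
  measurable E -> measurable E' -> measurable X -> P1 X = 1%E ->
  (forall x, X x -> P2 [set y | E (x, y)] = P2 [set y | E' (x, y)]) ->
  (P1 \x P2)%E E = (P1 \x P2)%E E'.
Proof.
move=> mE mE' mX PX EE'; apply: ae_eq_integral => //.
- exact: measurable_fun_xsection.
- exact: measurable_fun_xsection.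
apply: negligibleS (full_setC mX PX) => x /= + Xx; apply=> _.
by rewrite !xsectionE; exact: EE'.
Qed.

Lemma product_measure_cstx E (X : set T1) c :
  measurable E -> measurable X -> P1 X = 1%E ->
  (forall x, X x -> P2 [set y | E (x, y)] = c) ->
  (P1 \x P2)%E E = c.
Proof.
move=> mE mX PX Ec; transitivity (\int[P1]_x cst c x)%E.
  apply: ae_eq_integral => //; first exact: measurable_fun_xsection.
  apply: negligibleS (full_setC mX PX) => x /= + Xx; apply=> _.
  by rewrite xsectionE; exact: Ec.
rewrite integral_cst// -[RHS]mule1; congr (_ * _)%E.
exact: probability_setT.
Qed.

Lemma product_measure_csty E (Y : set T2) c :
  measurable E -> measurable Y -> P2 Y = 1%E ->
  (forall y, Y y -> P1 [set x | E (x, y)] = c) ->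
  (P1 \x P2)%E E = c.
Proof.
(* [\x^] integrates over the second factor; it agrees with [\x] on rectangles, hence everywhere. *)
move=> mE mY PY Ec; transitivity ((P1 \x^ P2)%E E).
  apply: product_measure_unique => // A B mA mB.
  by rewrite /= product_measure2E.
transitivity (\int[P2]_y cst c y)%E.
  apply: ae_eq_integral => //; first exact: measurable_fun_ysection.
  apply: negligibleS (full_setC mY PY) => y /= + Yy; apply=> _.
  by rewrite ysectionE; exact: Ec.
rewrite integral_cst// -[RHS]mule1; congr (_ * _)%E.
exact: probability_setT.
Qed.

End product_sections.

Section laws.
Context d (Om : measurableType d) (R : realType) (P : probability Om R).

Definition law d' (T : measurableType d') (X : Om -> T)
    (mX : measurable_fun setT X) : probability T R :=
  distribution P (HB.pack X (isMeasurableFun.Build _ _ _ _ X mX) : {mfun Om >-> T}).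

Lemma lawE d' (T : measurableType d') (X : Om -> T)
    (mX : measurable_fun setT X) A : law mX A = P (X @^-1` A).
Proof. by []. Qed.

(** Independence is the agreement of the joint law with the product law on rectangles, and
    rectangles determine the measure. *)
Lemma law_pair d1 d2 (T1 : measurableType d1) (T2 : measurableType d2)
    (X : Om -> T1) (Y : Om -> T2)
    (mX : measurable_fun setT X) (mY : measurable_fun setT Y) E :
  independent P X Y -> measurable E ->
  P [set w | E (X w, Y w)] = (law mX \x law mY)%E E.
Proof.
move=> XY mE; pose mXY := measurable_fun_pair mX mY.
by rewrite (product_measure_unique (m' := law mXY))// => A B mA mB; exact: XY.
Qed.

Definition update (T : Type) (I : finType) (k : I) (x : {ffun I -> T}) (t : T) :=
  [ffun i => if i == k then t else x i].

Lemma measurable_update d1 (aT : measurableType d1) d' (T : measurableType d')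
    (I : finType) (k : I) (x : aT -> {ffun I -> T}) (t : aT -> T) :
  measurable_fun setT x -> measurable_fun setT t ->
  measurable_fun setT (fun y => update k (x y) (t y)).
Proof.
move=> mx mt; apply: measurable_ffun => i.
under eq_fun do rewrite ffunE; case: (i == k) => //.
exact: measurable_ffun_app.
Qed.

Section mutual_independence.
Context d' (T : measurableType d') (n : nat) (X : 'I_n -> Om -> T).
Hypotheses (mX : forall i, measurable_fun setT (X i))
  (indX : mutually_independent P X).

Let Xs w := [ffun i => X i w].

Let mXs : measurable_fun setT Xs.
Proof.
by apply: measurable_ffun => i; under eq_fun do rewrite ffunE; exact: mX.
Qed.

Let rectangle (A : 'I_n -> set T) : set {ffun 'I_n -> T} :=
  [set x | forall i, A i (x i)].

Let mrectangle A : (forall i, measurable (A i)) -> measurable (rectangle A).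
Proof.
move=> mA; rewrite (_ : rectangle A =
    \bigcap_i ((fun x : {ffun 'I_n -> T} => x i) @^-1` A i)); last first.
  by apply/seteqP; split => [x Ax i _|x Ax i]; [exact: Ax|exact: Ax].
apply: fin_bigcap_measurable => [|i _]; first exact: finite_finset.
rewrite -[X in measurable X]setTI.
by apply: (@measurable_ffun_app _ _ _ T _ id) => //.
Qed.

Let rectangles := [set rectangle A | A in [set A | forall i, measurable (A i)]].

Let rectangles_generate :
  @measurable _ ({ffun 'I_n -> T} : measurableType _) = <<s rectangles >>.
Proof.
apply/seteqP; split; last first.
  apply: smallest_sub; first exact: sigma_algebra_measurable.
  by move=> _ [A mA <-]; exact: mrectangle.
apply: smallest_sub; first exact: smallest_sigma_algebra.
move=> _ [i _ [C mC <-]]; apply: sub_sigma_algebra.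
exists (fun j => if j == i then C else setT).
  by move=> j; case: ifP.
apply/seteqP; split => x /=.
  by move=> /(_ i); rewrite eqxx.
by move=> [_ Cx] j; case: eqP => [->|].
Qed.

Let prob_rectangle A : (forall i, measurable (A i)) ->
  P [set w | rectangle A (Xs w)] = (\prod_(i < n) fine (P (X i @^-1` A i)))%:E.
Proof.
move=> mA; rewrite -indX//; congr (P _); apply/seteqP; split => w /= Aw i.
  by move=> _; have := Aw i; rewrite ffunE.
by rewrite ffunE; exact: Aw.
Qed.

(** Overwriting coordinate [k] by an independent copy of [X k] does not change the joint law: both
    measures agree on rectangles, a generating family closed under intersection. *)
Lemma law_update k N : measurable N ->
  P [set w | N [ffun i => X i w]] =
  (law mXs \x law (mX k))%E [set xt | N (update k xt.1 xt.2)].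
Proof.
move=> mN; pose u (xt : {ffun 'I_n -> T} * T) := update k xt.1 xt.2.
have mu : measurable_fun setT u by exact: measurable_update.
pose U : {mfun ({ffun 'I_n -> T} * T)%type >-> {ffun 'I_n -> T}} :=
  HB.pack u (isMeasurableFun.Build _ _ _ _ u mu).
pose m2 := pushforward (law mXs \x law (mX k))%E U.
rewrite -[RHS]/(m2 N) -[LHS]/(law mXs N).
apply: (measure_unique rectangles (fun=> setT) _ _ _ _ (law mXs) m2) => //.
- move=> _ _ [A mA <-] [B mB <-]; exists (fun i => A i `&` B i).
    by move=> i; exact: measurableI.
  apply/seteqP; split => x /=; first by move=> AB; split=> i; case: (AB i).
  by move=> [Ax Bx] i; split.
- by move=> _; exists (fun=> setT) => //; apply/seteqP; split.
- by apply: bigcup_const; exists 0%N.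
- move=> _ [A mA <-].
  (* The overwritten coordinate is left unconstrained; its constraint [A k] bears on the new
     value. *)
  pose A' i := if i == k then setT else A i.
  have mA' i : measurable (A' i) by rewrite /A'; case: ifP.
  rewrite [LHS]prob_rectangle//.
  transitivity ((law mXs \x law (mX k))%E (rectangle A' `*` A k)).
    rewrite product_measure1E//; last exact: mrectangle.
    rewrite [X in (X * _)%E]prob_rectangle//.
    rewrite (bigD1 k)//= [in RHS](bigD1 k)//= {1}/A' eqxx.
    rewrite preimage_setT [P setT]probability_setT mul1r EFinM muleC.
    congr (_ * _)%E; last by rewrite fineK// fin_num_measure// -[X in measurable X]setTI; exact: mX.
    congr (_%:E); apply: eq_bigr => i ik; by rewrite /A' (negbTE ik).
  congr ((law mXs \x law (mX k))%E _); apply/seteqP; split => -[x t] /=.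
    move=> [Ax At] i; rewrite ffunE; case: eqP => [->//|/eqP ik].
    by have := Ax i; rewrite /A' (negbTE ik).
  move=> Axt; split=> [i|]; last by have := Axt k; rewrite ffunE eqxx.
  rewrite /A'; case: ifPn => // ik.
  by have := Axt i; rewrite ffunE (negbTE ik).
- move=> _; apply: (@le_lt_trans _ _ 1%E); last exact: ltry.
  exact: probability_le1.
Qed.

(** By Fubini, an event is null as soon as it is null for every choice of frozen values of the
    coordinates other than [k]. *)
Lemma null_update k N : measurable N ->
  (forall x, P [set w | N (update k x (X k w))] = 0%E) ->
  P [set w | N [ffun i => X i w]] = 0%E.
Proof.
move=> mN N0; rewrite (law_update k mN).
apply: (product_measure_cstx _ measurableT) => //.
- rewrite -[X in measurable X]setTI.
  apply: (@measurable_update _ ({ffun 'I_n -> T} * T)%type _ T) => //.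
- exact: probability_setT.
- by move=> x _; exact: N0.
Qed.

End mutual_independence.
End laws.

(** * Conditional invariance under conjugation *)

Lemma measurable_pred d1 d2 (T1 : measurableType d1) (T2 : measurableType d2)
    (f : T1 -> T2) (A : set T2) :
  measurable_fun setT f -> measurable A -> measurable [set x | A (f x)].
Proof. by move=> mf mA; have := mf measurableT A mA; rewrite setTI. Qed.

Lemma measurable_orthogonal (R : realType) d :
  measurable [set Q : 'M[R]_d | orthogonal_mx Q].
Proof.
rewrite (_ : mkset _ = \bigcap_ij
    [set Q : 'M[R]_d | (Q^T *m Q) ij.1 ij.2 = (1%:M : 'M[R]_d) ij.1 ij.2]); last first.
  by apply/seteqP; split => [Q /= oQ [i j] _ /=|Q /= oQ]; [rewrite oQ|
    apply/matrixP => i j; exact: (oQ (i, j))].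
apply: fin_bigcap_measurable => [|[i j] _ /=]; first exact: finite_finset.
apply: (@measurable_pred _ _ _ _ (fun Q : 'M[R]_d => (Q^T *m Q) i j) [set _]) => //.
by apply: measurable_entry; apply: measurable_mulmx => //; exact: measurable_trmx.
Qed.

Section conjugation_invariance.
Context (R : realType) (d : nat) (nu mu : probability 'M[R]_d R).
Hypothesis haar : haar_orthogonal nu.
Local Notation M := 'M[R]_d.

(* Conditionally on h, the law mu is invariant under conjugation by the
   stabilizer of the value of h: Y is a measurable choice, depending on L only
   through h L, of an element of the stabilizer of h L. *)
Definition conjugation_preserves (I : finType) (h : M -> {ffun I -> 'cV[R]_d}) :=
  forall Y : M -> M, measurable_fun setT Y -> (forall L, orthogonal_mx (Y L)) ->
  (forall L, fixes (Y L) (h L)) -> (forall L L', h L = h L' -> Y L = Y L') ->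
  forall A, measurable A -> mu [set L | A (conjugate (Y L) L)] = mu A.

Variables (I J : finType).
Variables (h : M -> {ffun I -> 'cV[R]_d}) (h' : M -> {ffun J -> 'cV[R]_d}).
Hypothesis mh : measurable_fun setT h.
(** Here [h'] plays the role of a history that extends [h]: the stabilizer of [h L] acts on it
    equivariantly, and its own stabilizer is smaller. *)
Hypothesis h'_equiv : forall L Q, orthogonal_mx Q -> fixes Q (h L) ->
  h' (conjugate Q L) = [ffun j => Q^T *m h' L j].
Hypothesis h'_fixes : forall L Q, fixes Q (h' L) -> fixes Q (h L).

Section random_conjugation.
Variable Y : M -> M.
Hypotheses (mY : measurable_fun setT Y) (oY : forall L, orthogonal_mx (Y L)).
Hypothesis Y_fixes : forall L, fixes (Y L) (h' L).
Hypothesis Y_eq : forall L L', h' L = h' L' -> Y L = Y L'.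

(** For Haar [U], a random element of the stabilizer of [h L]. The transpose makes left translations
    of it correspond to right translations of [U]. *)
Let q L U : M := (to_stab (h L) U)^T.

Let oq L U : orthogonal_mx U -> orthogonal_mx (q L U).
Proof. by move=> oU; apply/orthogonal_mx_tr/orthogonal_to_stab. Qed.

Let q_fixes L U : orthogonal_mx U -> fixes (q L U) (h L).
Proof.
move=> oU; apply: fixes_tr; first exact: orthogonal_to_stab.
exact: fixes_to_stab.
Qed.

Let qM L U S : orthogonal_mx S -> fixes S (h L) -> q L (U *m S^T) = S *m q L U.
Proof.
move=> oS Sh; rewrite /q to_stabM; last exact: fixes_tr.
by rewrite trmx_mul trmxK.
Qed.

Let mq d1 (aT : measurableType d1) (L U : aT -> M) :
  measurable_fun setT L -> measurable_fun setT U ->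
  measurable_fun setT (fun x => q (L x) (U x)).
Proof.
move=> mL mU; apply/measurable_trmx/measurable_to_stab => //.
exact: (measurableT_comp mh).
Qed.

(** Conjugating [L] by this matrix means conjugating by [q L U] and then by the value of [Y] at the
    result. *)
Let qY L U : M := q L U *m Y (conjugate (q L U) L).

Let mqY d1 (aT : measurableType d1) (L U : aT -> M) :
  measurable_fun setT L -> measurable_fun setT U ->
  measurable_fun setT (fun x => qY (L x) (U x)).
Proof.
move=> mL mU; apply: measurable_mulmx; first exact: mq.
by apply: (measurableT_comp mY); apply: measurable_conjugate => //; exact: mq.
Qed.

(** By equivariance [h'] takes the value q^T S^T h' L = q^T h' L at both conjugated matrices, so [Y]
    takes the same value there. *)
Let qY_translate L U S : orthogonal_mx U -> orthogonal_mx S ->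
  fixes S (h' L) -> qY L (U *m S^T) = S *m qY L U.
Proof.
move=> oU oS Sh'; have Sh : fixes S (h L) by exact: h'_fixes.
rewrite /qY qM// -mulmxA; congr (S *m (_ *m _)); apply: Y_eq.
rewrite !h'_equiv//; [|exact: oq|exact: q_fixes|exact/orthogonal_mxM/oq
  |exact/fixesM/q_fixes].
by apply/ffunP => j; rewrite !ffunE trmx_mul -mulmxA [S^T *m _]fix_trmx.
Qed.

(* With p := q Y q^T, which fixes h' L, one has q Y = p q; a Haar element of
   the stabilizer of h' L placed on the left absorbs p. *)
Let haar_stab L C : measurable C ->
  nu [set U | orthogonal_mx U /\ C (qY L U)] =
  nu [set U | orthogonal_mx U /\ C (q L U)].
Proof.
move=> mC; have [nu1 nuM] := haar.
pose s U := to_stab (h' L) U.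
have ms d1 (aT : measurableType d1) (U : aT -> M) :
    measurable_fun setT U -> measurable_fun setT (fun x => s (U x)).
  by move=> mU; apply: measurable_to_stab => //; exact: measurable_cst.
have mO d1 (aT : measurableType d1) (U f : aT -> M) : measurable_fun setT U ->
    measurable_fun setT f -> measurable [set x | orthogonal_mx (U x) /\ C (f x)].
  move=> mU mf; apply: measurableI; last exact: measurable_pred.
  exact: (measurable_pred mU (@measurable_orthogonal R d)).
pose E (f : M -> M) := [set p : M * M | orthogonal_mx p.1 /\ C (s p.2 *m f p.1)].
have mE f : measurable_fun setT f -> measurable (E f).
  move=> mf; apply: mO => //; apply: measurable_mulmx; first exact: ms.
  exact: (measurableT_comp mf).
(* A second Haar matrix U' supplies a left factor s U'. It does not change the law of f U, since it
   can be absorbed by right translation of U. *)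
have Ecst f : measurable_fun setT f ->
    (forall U S, orthogonal_mx U -> orthogonal_mx S -> fixes S (h' L) ->
       f (U *m S^T) = S *m f U) ->
    (nu \x nu)%E (E f) = nu [set U | orthogonal_mx U /\ C (f U)].
  move=> mf fM; apply: (product_measure_csty (mE _ mf) (@measurable_orthogonal R d)) => //.
  move=> U' oU'; have os : orthogonal_mx (s U') by exact: orthogonal_to_stab.
  have [_ <-] := nuM _ _ (orthogonal_mx_tr os) (mO _ _ _ _ (@measurable_id _ _ _) mf).
  congr (nu _); apply/seteqP; split => U /= [oU CU].
    split; first exact/orthogonal_mxM/orthogonal_mx_tr.
    by rewrite fM//; exact: fixes_to_stab.
  have oV' : orthogonal_mx U.
    rewrite -(mulmx1 U) -os mulmxA; exact: orthogonal_mxM.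
  by split => //; rewrite -fM//; exact: fixes_to_stab.
have mqL : measurable_fun setT (q L) by apply: mq => //; exact: measurable_cst.
have mqYL : measurable_fun setT (qY L) by apply: mqY => //; exact: measurable_cst.
rewrite -Ecst//; last by move=> U S; exact: qY_translate.
rewrite -Ecst//; last by move=> U S oU oS /h'_fixes; exact: qM.
apply: (product_measure_eqx (mE _ mqYL) (mE _ mqL) (@measurable_orthogonal R d)) => //.
move=> U /= oU; have oqU := oq L oU.
pose p := qY L U *m (q L U)^T.
have op : orthogonal_mx p.
  by apply/orthogonal_mxM/orthogonal_mx_tr => //; exact: orthogonal_mxM.
have ph' : fixes p (h' L).
  move=> j; rewrite /p /qY -!mulmxA.
  have := @Y_fixes (conjugate (q L U) L) j.
  rewrite h'_equiv//; last exact: q_fixes.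
  by rewrite ffunE => ->; rewrite orthogonal_mxVK.
have pq : qY L U = p *m q L U by rewrite /p -mulmxA oqU mulmx1.
rewrite (_ : [set _ | E (q L) _] = [set U' | orthogonal_mx U /\ C (s U' *m q L U)])//.
rewrite (_ : [set _ | E (qY L) _] =
  [set U' | orthogonal_mx U /\ C (s U' *m (p *m q L U))]); last by rewrite -pq.
(* Now U is frozen and U' is translated on the right by p: as p fixes h' L, s (U' p) = (s U') p. *)
have [_ <-] := nuM _ [set U' | orthogonal_mx U /\ C (s U' *m q L U)] op
  (mO _ _ _ _ (@measurable_cst _ _ _ _ _ U)
    (measurable_mulmx (ms _ _ _ (@measurable_id _ _ _)) (@measurable_cst _ _ _ _ _ (q L U)))).
congr (nu _); apply/seteqP; split => U' /= [_ CU']; split => //.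
  by rewrite /s to_stabM// -mulmxA.
by move: CU'; rewrite /s to_stabM// -mulmxA.
Qed.

(** An auxiliary Haar matrix [U] is inserted. For fixed [U], conjugation by [q L U] preserves [mu]
    by the hypothesis on [h]; for fixed [L], [qY L U] and [q L U] have the same law. Integrating in
    both orders combines the two facts. *)
Lemma conjugation_preserved_step A : conjugation_preserves h -> measurable A ->
  mu [set L | A (conjugate (Y L) L)] = mu A.
Proof.
move=> hP mA; have [nu1 nuM] := haar.
have mO f : measurable_fun setT f ->
    measurable [set p : M * M | orthogonal_mx p.2 /\ A (conjugate (f p) p.1)].
  move=> mf; apply: measurableI.
    exact: (measurable_pred measurable_snd (@measurable_orthogonal R d)).
  by apply: measurable_pred => //; exact: measurable_conjugate.
have mq2 : measurable_fun setT (fun p : M * M => q p.1 p.2) by exact: mq.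
have mqY2 : measurable_fun setT (fun p : M * M => qY p.1 p.2) by exact: mqY.
have q_preserves B U : measurable B -> orthogonal_mx U ->
    mu [set L | B (conjugate (q L U) L)] = mu B.
  move=> mB oU; apply: hP => //.
  - by apply: mq => //; exact: measurable_cst.
  - by move=> L; exact: oq.
  - by move=> L; exact: q_fixes.
  - by move=> L L' hL; rewrite /q hL.
transitivity ((mu \x nu)%E
    [set p | orthogonal_mx p.2 /\ A (conjugate (qY p.1 p.2) p.1)]).
  apply/esym; apply: (product_measure_csty (mO _ mqY2) (@measurable_orthogonal R d)) => //.
  move=> U oU; rewrite -(q_preserves _ U)//; last first.
    by apply: measurable_pred => //; exact: measurable_conjugate.
  by congr (mu _); apply/seteqP; split => L /=; rewrite conjugateM => // -[].
transitivity ((mu \x nu)%E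
    [set p | orthogonal_mx p.2 /\ A (conjugate (q p.1 p.2) p.1)]).
  apply: (product_measure_eqx (mO _ mqY2) (mO _ mq2) measurableT).
    exact: probability_setT.
  move=> L _; apply: (@haar_stab L [set g | A (conjugate g L)]).
  by apply: measurable_pred => //; apply: measurable_conjugate => //; exact: measurable_cst.
apply: (product_measure_csty (mO _ mq2) (@measurable_orthogonal R d)) => //.
move=> U oU; rewrite -(q_preserves _ U)//.
by congr (mu _); apply/seteqP; split => L /= => // -[].
Qed.

End random_conjugation.

Lemma conjugation_preserves_step :
  conjugation_preserves h -> conjugation_preserves h'.
Proof. by move=> hP Y mY oY Yh' Y_eq A; exact: conjugation_preserved_step. Qed.

End conjugation_invariance.

(** * Histories and coupling of two algorithms *)

(** Membership in $H_k$ for plain natural numbers, so that index arithmetic needs no ordinals. *)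
Definition in_H (k i j : nat) := (i + j <= k.+1)%N && (1 <= j <= k)%N.

Lemma in_H_val k (p : Hidx k) : in_H k (val p).1 (val p).2.
Proof. exact: (valP p). Qed.

Lemma in_HP k i j : in_H k i j ->
  exists p : Hidx k, nat_of_ord (val p).1 = i /\ nat_of_ord (val p).2 = j.
Proof.
move=> ij; have [ik jk] : (i < k.+1 /\ j < k.+1)%N.
  by case/and3P: ij => ij j0 jk; split=> //; lia.
by exists (exist _ (Ordinal ik, Ordinal jk) ij).
Qed.

Lemma in_HS k i j : in_H k i j -> in_H k.+1 i j.
Proof. by rewrite /in_H; lia. Qed.

Lemma in_H0 k j : (1 <= j <= k)%N -> in_H k 0 j.
Proof. by rewrite /in_H; lia. Qed.

Section histories.
Context (R : realType) (d : nat).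
Implicit Types (L Q : 'M[R]_d) (x : nat -> 'cV[R]_d) (v w : algorithm R d).

Lemma eq_powers k L L' x x' :
  (forall i j, in_H k i j -> L ^+ i *m x j = L' ^+ i *m x' j) <->
  powers k L x = powers k L' x'.
Proof.
split=> [E|/ffunP E i j /in_HP[p [<- <-]]].
  by apply/ffunP => p; rewrite !ffunE E// in_H_val.
by have := E p; rewrite !ffunE.
Qed.

Lemma fixes_powers k L x Q :
  fixes Q (powers k L x) <->
  forall i j, in_H k i j -> Q *m (L ^+ i *m x j) = L ^+ i *m x j.
Proof.
split=> [Qx i j /in_HP[p [<- <-]]|Qx p]; first by have := Qx p; rewrite !ffunE.
by rewrite !ffunE Qx// in_H_val.
Qed.

Lemma eq_alg_query v L L' k :
  (forall i j, in_H k i j ->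
     L ^+ i *m alg_query v L j = L' ^+ i *m alg_query v L' j) ->
  alg_query v L k.+1 = alg_query v L' k.+1.
Proof. by rewrite eq_powers !alg_queryE => ->. Qed.

Lemma alg_query_conjugate v n L Q : orthogonal_mx Q ->
  fixes Q (powers n L (alg_query v L)) ->
  forall j, (1 <= j <= n.+1)%N -> alg_query v (conjugate Q L) j = alg_query v L j.
Proof.
move=> oQ /fixes_powers QL; elim/ltn_ind => -[//|j] IHj jn.
apply: eq_alg_query => i m ijm; rewrite IHj; [|by case/and3P: ijm; lia..].
have mn : in_H n i m by move: ijm jn; rewrite /in_H; lia.
(* With exponent 0 the queries themselves belong to the history, so Q fixes them. *)
have m0 : in_H n 0 m by move: mn; rewrite /in_H; lia.
have := QL _ _ m0; rewrite expr0 mul1mx => Qm.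
by rewrite conjugateX// /conjugate -!mulmxA Qm fix_trmx// QL.
Qed.

Lemma powers_conjugate v n L Q : orthogonal_mx Q ->
  fixes Q (powers n L (alg_query v L)) ->
  powers n (conjugate Q L) (alg_query v (conjugate Q L)) =
  powers n L (alg_query v L).
Proof.
move=> oQ QL; apply/eq_powers => i j ij.
rewrite (alg_query_conjugate oQ QL); last by case/and3P: ij; lia.
move/fixes_powers : QL => QL; have := QL _ _ (@in_H0 n j _).
rewrite expr0 mul1mx => Qj.
rewrite conjugateX// /conjugate -!mulmxA Qj; last by case/and3P: ij; lia.
by rewrite fix_trmx// QL.
Qed.

(** A half-step between two histories: [None] indexes the next query. The information is that of the
    history, but the stabilizer must fix this query too, and so acts equivariantly on the next
    answers. *)
Definition with_query v (n : nat) L : {ffun option (Hidx n) -> 'cV[R]_d} :=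
  [ffun o => if o is Some p then powers n L (alg_query v L) p
             else alg_query v L n.+1].

Lemma fixes_with_query v n L Q : fixes Q (with_query v n L) <->
  fixes Q (powers n L (alg_query v L)) /\
  Q *m alg_query v L n.+1 = alg_query v L n.+1.
Proof.
split=> [Qv|[Qp Qv] [p|]]; last 2 first.
- by rewrite ffunE; exact: Qp.
- by rewrite ffunE.
by split=> [p|]; [have := Qv (Some p)|have := Qv None]; rewrite ffunE.
Qed.

(** All queries x_j with j at most n + 1 are fixed by Q, whence (Q^T L Q)^i x_j = Q^T L^i x_j. *)
Lemma powersS_conjugate v n L Q : orthogonal_mx Q ->
  fixes Q (with_query v n L) ->
  powers n.+1 (conjugate Q L) (alg_query v (conjugate Q L)) =
  [ffun p => Q^T *m powers n.+1 L (alg_query v L) p].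
Proof.
move=> oQ /fixes_with_query[Qp Qv]; apply/ffunP => p; rewrite !ffunE.
have := in_H_val p; move: (nat_of_ord _) (nat_of_ord _) => j i ij.
have jn : (1 <= j <= n.+1)%N by case/andP: ij.
rewrite (alg_query_conjugate oQ Qp)// conjugateX// /conjugate -!mulmxA.
congr (_ *m (_ *m _)); have [->//|jn'] := eqVneq j n.+1.
move/fixes_powers : Qp => /(_ 0%N j); rewrite expr0 mul1mx; apply.
by apply: in_H0; lia.
Qed.

End histories.

Section measurable_histories.
Context (R : realType) (d K : nat) d1 (aT : measurableType d1).
(** The algorithm may vary with the outcome, since the simulated one depends on the Gaussian
    vectors. *)
Variables (V : aT -> algorithm R d) (L : aT -> 'M[R]_d).
Hypotheses (mL : measurable_fun setT L).

Lemma measurable_powers n (x : aT -> nat -> 'cV[R]_d) :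
  (forall j, (1 <= j <= n)%N -> measurable_fun setT (fun t => x t j)) ->
  measurable_fun setT (fun t => powers n (L t) (x t)).
Proof.
move=> mx; apply: measurable_ffun => p; under eq_fun do rewrite ffunE.
apply: measurable_mulmx; first exact: measurable_expmx.
by apply: mx; have /andP[] := in_H_val p.
Qed.

Hypothesis mV : forall k, (k < K)%N ->
  forall F : aT -> {ffun Hidx k -> 'cV[R]_d}, measurable_fun setT F ->
  measurable_fun setT (fun t => @V t k.+1 (F t)).

Lemma measurable_alg_query j : (1 <= j <= K)%N ->
  measurable_fun setT (fun t => alg_query (V t) (L t) j).
Proof.
elim/ltn_ind: j => -[//|j] IHj jK; under eq_fun do rewrite alg_queryE.
by apply: mV => //; apply: measurable_powers => m mj; apply: IHj; lia.
Qed.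

Lemma measurable_history n : (n <= K)%N ->
  measurable_fun setT (fun t => powers n (L t) (alg_query (V t) (L t))).
Proof.
move=> nK; apply: measurable_powers => j jn; apply: measurable_alg_query.
by lia.
Qed.

End measurable_histories.

Lemma measurable_algorithm_app (R : realType) d K (v : algorithm R d)
    d1 (aT : measurableType d1) : measurable_algorithm K v ->
  forall k, (k < K)%N ->
  forall F : aT -> {ffun Hidx k -> 'cV[R]_d}, measurable_fun setT F ->
  measurable_fun setT (fun t => v k.+1 (F t)).
Proof. by move=> mv k kK F mF; exact: (measurableT_comp (mv k.+1 kK) mF). Qed.

Section history_conditioning.
Context (R : realType) (d K : nat) (nu mu : probability 'M[R]_d R).
Variable v : algorithm R d.
Hypotheses (haar : haar_orthogonal nu) (mv : measurable_algorithm K v).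
Hypothesis mu_inv : forall Q A, orthogonal_mx Q -> measurable A ->
  mu [set L | A (conjugate Q L)] = mu A.

Lemma history_preserves n : (n <= K)%N ->
  conjugation_preserves mu (fun L => powers n L (alg_query v L)).
Proof.
have mh m : (m <= K)%N ->
    measurable_fun setT (fun L : 'M[R]_d => powers m L (alg_query v L)).
  move=> mK; apply: (measurable_history (K := K)) => //.
  exact: measurable_algorithm_app.
elim: n => [_ Y mY oY Yh Yeq A mA|n IHn nK].
  rewrite -[RHS](mu_inv (oY 0) mA).
  congr (mu _); apply/seteqP.
  (* The history of length 0 is empty, so [Y] is constant and plain invariance of [mu] suffices. *)
  have Y0 L : Y L = Y 0.
    by apply: Yeq; apply/eq_powers => i j; rewrite /in_H; lia.
  by split => L /=; rewrite Y0.
apply: (conjugation_preserves_step haar (h := with_query v n)).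
- apply: measurable_ffun => -[p|].
    under eq_fun do rewrite ffunE.
    by apply: measurable_ffun_app; apply: mh; lia.
  under eq_fun do rewrite ffunE.
  by apply: (measurable_alg_query (K := K)) => //; exact: measurable_algorithm_app.
- by move=> L Q oQ Qh; exact: powersS_conjugate.
- move=> L Q /fixes_powers Qh; apply/fixes_with_query; split.
    by apply/fixes_powers => i j /in_HS; exact: Qh.
  by have := Qh 0%N n.+1; rewrite expr0 mul1mx; apply; apply: in_H0; lia.
(* The next query is a function of the history, so a [Y] admissible for [with_query] is admissible
   for the history of length n. *)
- move=> Y mY oY Yh Yeq A mA; apply: IHn => //; first lia.
  + by move=> L; have /fixes_with_query[] := Yh L.
  + by move=> L L' LL'; apply: Yeq; apply/ffunP => o; rewrite !ffunE !alg_queryE LL'.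
Qed.

End history_conditioning.

Section coupling.
Context (R : realType) (d K : nat).
Implicit Types (L Q : 'M[R]_d) (X : nat -> nat -> 'cV[R]_d).

Definition table_slice n (Q : 'M[R]_d) X : {ffun Hidx n -> 'cV[R]_d} :=
  [ffun p : Hidx n => Q^T *m X (val p).1 (val p).2].

(* U_1 ... U_n, where X i j stands for L^i w_j; the slice at rotation n' is then
   the history of v on the matrix conjugated by U_1 ... U_n'. *)
Fixpoint rotation (v : algorithm R d) (n : nat) X : 'M[R]_d :=
  if n is n'.+1 then
    let Q := rotation v n' X in
    Q *m reflection (Q^T *m X 0%N n'.+1 - @v n'.+1 (table_slice n' Q X))
  else 1%:M.

(** The single factor $U_{n+1}$ of the product. *)
Definition rotation_step (v : algorithm R d) n X : 'M[R]_d :=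
  let Q := rotation v n X in
  reflection (Q^T *m X 0%N n.+1 - @v n.+1 (table_slice n Q X)).

Lemma orthogonal_rotation v n X : orthogonal_mx (rotation v n X).
Proof.
elim: n => [|n IHn] /=; first exact: orthogonal_mx1.
exact/(orthogonal_mxM IHn)/orthogonal_reflection.
Qed.

Lemma eq_rotation v n X X' :
  (forall i j, in_H n i j -> X i j = X' i j) -> rotation v n X = rotation v n X'.
Proof.
elim: n => [//|n IHn] E /=; rewrite IHn; last by move=> i j /in_HS; exact: E.
have -> Q : table_slice n Q X = table_slice n Q X'.
  by apply/ffunP => p; rewrite !ffunE E// in_HS// in_H_val.
by rewrite E// in_H0//; lia.
Qed.

Definition query_table (w : algorithm R d) L i j : 'cV[R]_d :=
  L ^+ i *m alg_query w L j.

Variables v w : algorithm R d.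
Hypotheses (mv : measurable_algorithm K v) (mw : measurable_algorithm K w).
Hypotheses (ov : orthonormal_queries K v) (ow : orthonormal_queries K w).

Local Notation hist n L := (powers n L (alg_query v L)).

(* The same product U_1 ... U_n, read off the history of v instead of that of w. *)
Fixpoint back_rotation n L : 'M[R]_d :=
  if n is n'.+1 then
    let Q := back_rotation n' L in
    Q *m reflection (Q^T *m @w n'.+1 [ffun p : Hidx n' => Q *m hist n' L p]
                     - @v n'.+1 (hist n' L))
  else 1%:M.

Definition back_step n L : 'M[R]_d :=
  let Q := back_rotation n L in
  reflection (Q^T *m @w n.+1 [ffun p : Hidx n => Q *m hist n L p] - @v n.+1 (hist n L)).

(** Each factor is evaluated at the current matrix and depends on it only through its [v]-history;
    this is the kind of conjugation that [history_preserves] covers. *)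
Fixpoint transport n L : 'M[R]_d :=
  if n is n'.+1 then
    let L' := transport n' L in conjugate (back_step n' L') L'
  else L.

Lemma orthogonal_back_rotation n L : orthogonal_mx (back_rotation n L).
Proof.
elim: n => [|n IHn] /=; first exact: orthogonal_mx1.
exact/(orthogonal_mxM IHn)/orthogonal_reflection.
Qed.

Lemma hist_le m n L L' : (m <= n)%N -> hist n L = hist n L' -> hist m L = hist m L'.
Proof.
move=> mn /eq_powers E; apply/eq_powers => i j ij; apply: E.
by move: ij; rewrite /in_H; lia.
Qed.

Lemma eq_back_rotation n L L' : hist n L = hist n L' ->
  back_rotation n.+1 L = back_rotation n.+1 L'.
Proof.
move=> LL'; have E m : (m <= n.+1)%N -> back_rotation m L = back_rotation m L'.
  elim: m => [//|m IHm] mn /=; rewrite IHm; last exact: ltnW.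
  by rewrite (@hist_le m n _ _ mn LL').
exact: E.
Qed.

Lemma eq_back_step n L L' : hist n L = hist n L' -> back_step n L = back_step n L'.
Proof.
move=> LL'; have := eq_back_rotation LL'; rewrite /back_step LL'.
suff -> : back_rotation n L = back_rotation n L' by [].
by case: n LL' => [//|n] LL'; exact/eq_back_rotation/(hist_le (leqnSn n) LL').
Qed.

(** Both the query of [v] and the rotated query of [w] are orthogonal to the history, hence so is
    their difference. *)
Lemma fixes_back_step n L : (n < K)%N -> fixes (back_step n L) (hist n L).
Proof.
move=> nK p; apply: reflection_id; rewrite dotvBl.
have oQ := orthogonal_back_rotation n L; set Q := back_rotation n L in oQ *.
have [_ vp] := @ov n.+1 nK (hist n L).
have [_ wp] := @ow n.+1 nK [ffun p : Hidx n => Q *m hist n L p].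
rewrite vp subr0 -(orthogonal_mx_dotv _ _ oQ) orthogonal_mxVK//.
by have := wp p; rewrite ffunE.
Qed.

Lemma back_rotationS n L :
  back_rotation n.+1 L = back_rotation n L *m back_step n L.
Proof. by []. Qed.

Lemma rotationS n X : rotation v n.+1 X = rotation v n X *m rotation_step v n X.
Proof. by []. Qed.

(** The run of [w] on [L] and the run of [v] on the conjugated matrix proceed in lockstep. The third
    clause says that the rotation can be recovered from the history of [v] alone, which makes the
    next step admissible. *)
Lemma transport_invariant n L : (n <= K)%N ->
  let Q := rotation v n (query_table w L) in
  [/\ transport n L = conjugate Q L,
      hist n (transport n L) = table_slice n Q (query_table w L) &
      back_rotation n (transport n L) = Q].
Proof.
elim: n => [_|n IHn nK] /=.
  split; rewrite ?conjugate1//; apply/ffunP => p.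
  by have := in_H_val p; rewrite /in_H; lia.
have [] := IHn (ltnW nK); set X := query_table w L; set L1 := transport n L.
set Q := rotation v n X => L1E histL1 backL1.
have oQ : orthogonal_mx Q by exact: orthogonal_rotation.
have whist : [ffun p : Hidx n => Q *m hist n L1 p] = powers n L (alg_query w L).
  apply/ffunP => p; rewrite ffunE histL1 ffunE orthogonal_mxVK// ffunE.
  by [].
have X0 : X 0%N n.+1 = alg_query w L n.+1.
  by rewrite /X /query_table expr0 mul1mx.
have stepE : back_step n L1 = rotation_step v n X.
  by rewrite /back_step backL1 whist /rotation_step -/Q -histL1 X0 alg_queryE.
set S := back_step n L1 in stepE *.
have oS : orthogonal_mx S by exact: orthogonal_reflection.
have Sfix : fixes S (hist n L1) by exact: fixes_back_step.
have L2E : conjugate S L1 = conjugate (Q *m S) L by rewrite conjugateM -L1E.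
have hist2 : hist n (conjugate S L1) = hist n L1 by exact: powers_conjugate.
rewrite -[reflection _]/(rotation_step v n X) -stepE; split => //; last first.
  by rewrite -/(back_rotation n.+1 _) (eq_back_rotation hist2) back_rotationS backL1.
(* The rotation Q S takes the queries of [v] to those of [w]. They may be read on L1, since
   conjugation by S does not alter the first n + 1 queries. *)
have query2 j : (1 <= j <= n.+1)%N ->
    Q *m S *m alg_query v L1 j = alg_query w L j.
  move=> jn; have [->|jn1] := eqVneq j n.+1.
    (* For the new query, the reflection S exchanges two unit vectors. *)
    have -> : alg_query v L1 n.+1 = S *m (Q^T *m alg_query w L n.+1).
      rewrite stepE /rotation_step -/Q X0 -histL1 -alg_queryE.
      rewrite reflection_swap// orthogonal_mx_dotv; last exact: orthogonal_mx_tr.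
      rewrite !alg_queryE; have [-> _] := @ov n.+1 nK (hist n L1).
      by have [-> _] := @ow n.+1 nK (powers n L (alg_query w L)).
    by rewrite -mulmxA /S reflectionK orthogonal_mxVK.
  have jn' : in_H n 0 j by apply: in_H0; lia.
  have /fixes_powers/(_ _ _ jn') := Sfix; rewrite expr0 mul1mx -mulmxA => ->.
  have /ffunP := histL1; have [p [p1 p2]] := in_HP jn'.
  move=> /(_ p); rewrite !ffunE p1 p2 expr0 mul1mx => ->.
  by rewrite orthogonal_mxVK// /X /query_table expr0 mul1mx.
apply/ffunP => p; rewrite !ffunE L2E conjugateX; last exact: orthogonal_mxM.
have /andP[_ pn] := in_H_val p; rewrite -L2E (alg_query_conjugate oS Sfix)//.
by rewrite /conjugate -[LHS]mulmxA query2// -mulmxA.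
Qed.

Lemma transport_history L :
  hist K (transport K L) =
  [ffun p : Hidx K => (rotation v K (query_table w L))^T *m
     powers K L (alg_query w L) p].
Proof.
have [_ -> _] := transport_invariant L (leqnn K).
by apply/ffunP => p; rewrite !ffunE.
Qed.

Lemma measurable_hist n : (n <= K)%N ->
  measurable_fun setT (fun L : 'M[R]_d => hist n L).
Proof.
move=> nK; apply: (measurable_history (K := K)) => //.
exact: measurable_algorithm_app.
Qed.

Lemma measurable_back_rotation n : (n <= K)%N ->
  measurable_fun setT (back_rotation n).
Proof.
elim: n => [_|n IHn nK]; first exact: measurable_cst.
have mh := measurable_hist (ltnW nK); have mQ := IHn (ltnW nK).
apply: measurable_mulmx => //; apply/measurable_reflection/measurable_submx.
  apply: measurable_mulmx; first exact: measurable_trmx.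
  apply: (measurable_algorithm_app mw) => //; apply: measurable_ffun => p.
  under eq_fun do rewrite ffunE.
  by apply: measurable_mulmx => //; exact: measurable_ffun_app.
exact: (measurable_algorithm_app mv).
Qed.

Lemma measurable_back_step n : (n < K)%N -> measurable_fun setT (back_step n).
Proof.
move=> nK.
have -> : back_step n = fun L => (back_rotation n L)^T *m back_rotation n.+1 L.
  apply/funext => L; rewrite back_rotationS orthogonal_mxK//.
  exact: orthogonal_back_rotation.
apply: measurable_mulmx; last exact: measurable_back_rotation.
by apply: measurable_trmx; apply: measurable_back_rotation; exact: ltnW.
Qed.

Variables (nu mu : probability 'M[R]_d R).
Hypothesis haar : haar_orthogonal nu.
Hypothesis mu_inv : forall Q A, orthogonal_mx Q -> measurable A ->
  mu [set L | A (conjugate Q L)] = mu A.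

Lemma transport_preserves n A : (n <= K)%N -> measurable A ->
  mu [set L | A (transport n L)] = mu A.
Proof.
elim: n A => [//|n IHn] A nK mA /=.
have mS := measurable_back_step nK.
rewrite (IHn [set L | A (conjugate (back_step n L) L)]) ?(ltnW nK)//; last first.
  by apply: measurable_pred => //; exact: measurable_conjugate.
apply: (history_preserves haar mv mu_inv (ltnW nK)) => //.
- by move=> L; exact: orthogonal_reflection.
- by move=> L; exact: fixes_back_step.
- by move=> L L'; exact: eq_back_step.
Qed.

(** The rotated history of [w] on L is the history of [v] on [transport K L], and [transport K]
    preserves [mu]. *)
Lemma coupled_law A : measurable A ->
  mu [set L | A [ffun p : Hidx K => (rotation v K (query_table w L))^T *m
                   powers K L (alg_query w L) p]] =
  mu [set L | A (powers K L (alg_query v L))].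
Proof.
move=> mA; have mB := measurable_pred (measurable_hist (leqnn K)) mA.
rewrite -[RHS](transport_preserves (leqnn K) mB).
by congr (mu _); apply/seteqP; split => L /=; rewrite transport_history.
Qed.

End coupling.

(** * The simulated algorithm *)

Section residuals.
Context (R : realType) (d : nat).
Implicit Types (x y z : 'cV[R]_d) (s : seq 'cV[R]_d) (L : 'M[R]_d).

(* Component of z orthogonal to s.  Division by dotv x' x' = 0 is harmless:
   x' = 0 then. *)
Fixpoint residual s z : 'cV[R]_d :=
  if s is x :: s' then
    let x' := residual s' x in let z' := residual s' z in
    z' - (dotv x' z' / dotv x' x') *: x'
  else z.

(* Applies to second components the linear combination that computes the
   residual of the first ones. *)
Fixpoint lifted_residual (s : seq ('cV[R]_d * 'cV[R]_d))
    (z : 'cV[R]_d * 'cV[R]_d) : 'cV[R]_d * 'cV[R]_d :=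
  if s is x :: s' then
    let x' := lifted_residual s' x in let z' := lifted_residual s' z in
    let c := dotv x'.1 z'.1 / dotv x'.1 x'.1 in
    (z'.1 - c *: x'.1, z'.2 - c *: x'.2)
  else z.

Lemma lifted_residualE L s z :
  lifted_residual [seq (x, L *m x) | x <- s] (z, L *m z) =
  (residual s z, L *m residual s z).
Proof.
elim: s z => [//|x s IHs] z /=; rewrite !IHs /=.
by rewrite mulmxBr -scalemxAr.
Qed.

Lemma dotv_residual s y z :
  {in s, forall x, dotv y x = 0} -> dotv y (residual s z) = dotv y z.
Proof.
elim: s z => [//|x s IHs] z ys /=.
have ys' : {in s, forall x, dotv y x = 0}.
  by move=> x' x's; apply: ys; rewrite inE x's orbT.
by rewrite dotvBr dotvZr !IHs// (ys x) ?mem_head// mulr0 subr0.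
Qed.

Lemma residual_orthogonal s z : {in s, forall x, dotv (residual s z) x = 0}.
Proof.
elim: s z => [//|x s IHs] z; set r := residual _ z.
have rs : {in s, forall x, dotv r x = 0}.
  by move=> y ys; rewrite /r /= dotvBl dotvZl (IHs z y ys) (IHs x y ys) mulr0 subr0.
move=> y; rewrite inE => /predU1P[->|]; last exact: rs.
(* As r is orthogonal to s, <r, x> = <r, x'> with x' the residual of x, and the projection
   coefficient cancels this product. *)
rewrite -(dotv_residual x rs) /r /= dotvBl dotvZl.
set x' := residual s x; have [x'0|x'0] := eqVneq (dotv x' x') 0.
  rewrite x'0 mulr0 subr0; move/eqP: x'0; rewrite dotv_eq0 => /eqP ->.
  exact: dotv0.
by rewrite divfK// dotvC subrr.
Qed.

Lemma unit_normalize z : dotv z z != 0 ->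
  unit_vector ((Num.sqrt (dotv z z))^-1 *: z).
Proof.
move=> z0; rewrite /unit_vector dotvZl dotvZr mulrA -expr2 exprVn.
by rewrite sqr_sqrtr ?dotv_ge0// mulVf.
Qed.

(** The matrix with columns [s] has rank below d, so its left kernel is nonzero. *)
Lemma exists_orthogonal s : (size s < d)%N ->
  exists2 c : 'cV[R]_d, c != 0 & {in s, forall x, dotv c x = 0}.
Proof.
move=> sd; pose A := \matrix_(i < d, j < size s) (s`_j) i 0.
have : kermx A != 0.
  rewrite kermx_eq0 -row_leq_rank -ltnNge (leq_ltn_trans _ sd)//.
  exact: rank_leq_col.
case/rowV0Pn => u /sub_kermxP uA u0.
exists u^T; first by rewrite -(inj_eq trmx_inj) trmxK trmx0.
move=> x /(nthP 0)[j js <-]; rewrite dotvE trmxK.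
have /rowP/(_ (Ordinal js)) := uA; rewrite !mxE => {2}<-.
by apply: eq_bigr => i _; rewrite mxE.
Qed.

End residuals.

Section measurable_residuals.
Context d1 (aT : measurableType d1) (R : realType) (d : nat).

Lemma measurable_residual (I : Type) (s : seq I) (f : I -> aT -> 'cV[R]_d)
    (z : aT -> 'cV[R]_d) :
  (forall i, measurable_fun setT (f i)) -> measurable_fun setT z ->
  measurable_fun setT (fun t => residual [seq f i t | i <- s] (z t)).
Proof.
move=> mf; elim: s z => [//|i s IHs] z mz /=.
have mi := IHs _ (mf i); have mz' := IHs _ mz.
apply: measurable_submx => //; apply: measurable_scalemx => //.
apply: measurable_funM; first exact: measurable_dotv.
exact/measurable_funV/measurable_dotv.
Qed.

Lemma measurable_lifted_residual (I : Type) (s : seq I)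
    (f g : I -> aT -> 'cV[R]_d) (z u : aT -> 'cV[R]_d) :
  (forall i, measurable_fun setT (f i)) ->
  (forall i, measurable_fun setT (g i)) ->
  measurable_fun setT z -> measurable_fun setT u ->
  let r t := lifted_residual [seq (f i t, g i t) | i <- s] (z t, u t) in
  measurable_fun setT (fun t => (r t).1) /\ measurable_fun setT (fun t => (r t).2).
Proof.
move=> mf mg; elim: s z u => [//|i s IHs] z u mz mu /=.
have [mi1 mi2] := IHs _ _ (mf i) (mg i); have [mz1 mz2] := IHs _ _ mz mu.
by split; apply: measurable_submx => //; apply: measurable_scalemx => //;
  (apply: measurable_funM; [exact: measurable_dotv|
    exact/measurable_funV/measurable_dotv]).
Qed.

End measurable_residuals.

Section simulated_queries.
Context (R : realType) (d K : nat) (v : algorithm R d).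
Hypotheses (mv : measurable_algorithm K v) (ov : orthonormal_queries K v).
Implicit Types (L : 'M[R]_d) (y : nat -> 'cV[R]_d).

(* Where the residual vanishes, a null event, the query of v keeps the
   algorithm orthonormal. *)
Definition simulated y : algorithm R d := fun k F =>
  let r := residual [seq F p | p <- enum (Hidx k.-1)] (y k) in
  if dotv r r == 0 then @v k F else (Num.sqrt (dotv r r))^-1 *: r.

Lemma orthonormal_simulated y : orthonormal_queries K (simulated y).
Proof.
move=> k kK F; rewrite /simulated; case: ifPn => [_|r0]; first exact: ov.
split; first exact: unit_normalize.
move=> p; rewrite dotvZl [X in _ * X]residual_orthogonal ?mulr0//.
by apply/mapP; exists p; rewrite ?mem_enum.
Qed.

Lemma measurable_simulated d1 (aT : measurableType d1) (y : aT -> nat -> 'cV[R]_d)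
    k (F : aT -> {ffun Hidx k -> 'cV[R]_d}) : (k < K)%N ->
  measurable_fun setT (fun t => y t k.+1) -> measurable_fun setT F ->
  measurable_fun setT (fun t => simulated (y t) (F t : {ffun Hidx k.+1.-1 -> _})).
Proof.
move=> kK my mF; rewrite /simulated.
have mr : measurable_fun setT (fun t =>
    residual [seq F t p | p <- enum (Hidx k)] (y t k.+1)).
  apply: (measurable_residual _ (f := fun p t => F t p)) => // p.
  exact: measurable_ffun_app.
apply: measurable_fun_ifT.
- by apply: measurable_fun_eqr => //; exact: measurable_dotv.
- exact: (measurable_algorithm_app mv).
- apply: measurable_scalemx => //; apply/measurable_funV/measurable_funsqrt.
  exact: measurable_dotv.
Qed.

Lemma measurable_algorithm_simulated y : measurable_algorithm K (simulated y).
Proof.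
move=> [//|k] kK; apply: (measurable_simulated (y := fun=> y)) => //.
Qed.

Lemma eq_simulated y y' L m : (forall j, (1 <= j <= m)%N -> y j = y' j) ->
  forall j, (j <= m)%N -> alg_query (simulated y) L j = alg_query (simulated y') L j.
Proof.
move=> yy'; elim/ltn_ind => -[//|j] IHj jm.
have E : powers j L (alg_query (simulated y) L) =
         powers j L (alg_query (simulated y') L).
  by apply/eq_powers => i l /and3P[_ l0 lj]; rewrite IHj//; lia.
by rewrite !alg_queryE E /simulated yy'//.
Qed.

(** The condition under which none of the first [n] simulated queries falls back on [v], so that
    they are explicit linear combinations of the data. *)
Definition nonvanishing_residuals n y L := forall m, (m < n)%N ->
  let r := residual [seq powers m L (alg_query (simulated y) L) p
                    | p <- enum (Hidx m)] (y m.+1) in dotv r r != 0.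

(* From A i j = L^i z_j computes L^i w_j: the combination giving w_j from z_j and
   earlier vectors is applied to their images by L^i. *)
Fixpoint reconstruct_table n (A : nat -> nat -> 'cV[R]_d) : nat -> nat -> 'cV[R]_d :=
  if n is n'.+1 then fun i j =>
    let B := reconstruct_table n' A in
    if j == n'.+1 then
      let r := lifted_residual
        [seq (B (val p).1 (val p).2, B (i + (val p).1)%N (val p).2)
        | p : Hidx n' <- enum (Hidx n')] (A 0%N n'.+1, A i n'.+1) in
      (Num.sqrt (dotv r.1 r.1))^-1 *: r.2
    else B i j
  else fun _ _ => 0.

(** [N] stays fixed in the induction because column n + 1 calls for higher powers in earlier
    columns. They are available: (k, l) in $H_n$ and (i, n + 1) in $H_N$ give i + k + l <= N + 1. *)
Lemma reconstruct_tableE N n y L A : (n <= N)%N ->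
  (forall i j, in_H N i j -> A i j = L ^+ i *m y j) -> nonvanishing_residuals n y L ->
  forall i j, in_H N i j -> (j <= n)%N ->
  reconstruct_table n A i j = L ^+ i *m alg_query (simulated y) L j.
Proof.
move=> + AE; elim: n => [_ _ i j|n IHn nN nd i j ij]; first by rewrite /in_H; lia.
have {}IHn := IHn (ltnW nN) (fun m mn => nd m (ltnW mn)).
rewrite leq_eqVlt => /predU1P[jn|jn] /=; last first.
  by rewrite (ltn_eqF jn) IHn.
rewrite jn eqxx; rewrite jn in ij => {j jn}.
set x := [seq powers n L (alg_query (simulated y) L) p | p <- enum (Hidx n)].
rewrite (_ : [seq _ | p <- _] = [seq (u, L ^+ i *m u) | u <- x]); last first.
  rewrite /x -[RHS]map_comp; apply: eq_map => p /=; rewrite ffunE.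
  have := in_H_val p; move: (nat_of_ord _) (nat_of_ord _) => k l kl.
  rewrite !IHn ?mulmxA -?exprD//; move: kl ij; rewrite /in_H; try by lia.
  by rewrite mulmxE exprD.
rewrite !AE//; last by move: ij; rewrite /in_H; lia.
rewrite expr0 mul1mx lifted_residualE /= scalemxAr; congr (_ *m _).
by rewrite alg_queryE /simulated/= -/x (negbTE (nd n _)).
Qed.

(** A total table, 0 outside $H_k$, as input for [reconstruct_table]. *)
Definition entries k (F : {ffun Hidx k -> 'cV[R]_d}) i j : 'cV[R]_d :=
  if [pick p : Hidx k | (nat_of_ord (val p).1 == i) && (nat_of_ord (val p).2 == j)]
    is Some p then F p else 0.

Lemma entries_powers k L y i j : in_H k i j ->
  entries (powers k L y) i j = L ^+ i *m y j.
Proof.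
move=> /in_HP[p [<- <-]]; rewrite /entries; case: pickP => [q /andP[/eqP q1 /eqP q2]|].
  by rewrite ffunE q1 q2.
by move/(_ p); rewrite !eqxx.
Qed.

Definition reconstruct k (F : {ffun Hidx k -> 'cV[R]_d}) :
    {ffun Hidx k -> 'cV[R]_d} :=
  [ffun p : Hidx k => reconstruct_table k (entries F) (val p).1 (val p).2].

Lemma reconstructE k y y' L : nonvanishing_residuals k y L ->
  (forall j, (1 <= j <= k)%N -> y' j = y j) ->
  reconstruct (powers k L y') = powers k L (alg_query (simulated y) L).
Proof.
move=> nd yy'; apply/ffunP => p; rewrite !ffunE.
have pH := in_H_val p; apply: (reconstruct_tableE (leqnn k)) => //.
  by move=> i j ij; rewrite entries_powers// yy'//; case/andP: ij.
by case/and3P: pH.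
Qed.

Lemma measurable_reconstruct_table d1 (aT : measurableType d1) n
    (A : aT -> nat -> nat -> 'cV[R]_d) :
  (forall i j, measurable_fun setT (fun t => A t i j)) ->
  forall i j, measurable_fun setT (fun t => reconstruct_table n (A t) i j).
Proof.
move=> mA; elim: n => [|n IHn] i j /=; first exact: measurable_cst.
case: (j == n.+1); last exact: IHn.
have [m1 m2] := @measurable_lifted_residual _ aT R d _ (enum (Hidx n))
  (fun (p : Hidx n) t => reconstruct_table n (A t) (val p).1 (val p).2)
  (fun (p : Hidx n) t => reconstruct_table n (A t) (i + (val p).1)%N (val p).2)
  _ _ (fun p => IHn _ _) (fun p => IHn _ _) (mA 0%N n.+1) (mA i n.+1).
apply: measurable_scalemx => //; apply/measurable_funV/measurable_funsqrt.
exact: measurable_dotv.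
Qed.

Lemma measurable_entries d1 (aT : measurableType d1) k
    (F : aT -> {ffun Hidx k -> 'cV[R]_d}) i j :
  measurable_fun setT F -> measurable_fun setT (fun t => entries (F t) i j).
Proof.
move=> mF; rewrite /entries; case: pickP => [p _|_]; last exact: measurable_cst.
exact: measurable_ffun_app.
Qed.

Lemma measurable_reconstruct k :
  measurable_fun setT (@reconstruct k).
Proof.
apply: measurable_ffun => p; under eq_fun do rewrite ffunE.
by apply: measurable_reconstruct_table => i j; exact: measurable_entries.
Qed.

Lemma measurable_rotation d1 (aT : measurableType d1) n
    (X : aT -> nat -> nat -> 'cV[R]_d) : (n <= K)%N ->
  (forall i j, in_H n i j -> measurable_fun setT (fun t => X t i j)) ->
  measurable_fun setT (fun t => rotation v n (X t)).
Proof.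
elim: n => [|n IHn] nK mX; first exact: measurable_cst.
have mQ := IHn (ltnW nK) (fun i j ij => mX i j (in_HS ij)).
have mQT := measurable_trmx mQ.
apply: measurable_mulmx => //; apply/measurable_reflection/measurable_submx.
  by apply: measurable_mulmx => //; apply: mX; apply: in_H0; lia.
apply: (measurable_algorithm_app mv) => //; apply: measurable_ffun => p.
under eq_fun do rewrite ffunE.
by apply: measurable_mulmx => //; apply/mX/in_HS/in_H_val.
Qed.

Lemma measurable_rotation_step d1 (aT : measurableType d1) n
    (X : aT -> nat -> nat -> 'cV[R]_d) : (n < K)%N ->
  (forall i j, in_H n.+1 i j -> measurable_fun setT (fun t => X t i j)) ->
  measurable_fun setT (fun t => rotation_step v n (X t)).
Proof.
move=> nK mX.
have -> : (fun t => rotation_step v n (X t)) =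
    fun t => (rotation v n (X t))^T *m rotation v n.+1 (X t).
  apply/funext => t; rewrite rotationS orthogonal_mxK//.
  exact: orthogonal_rotation.
apply: measurable_mulmx; last exact: measurable_rotation.
apply/measurable_trmx/measurable_rotation; first exact: ltnW.
by move=> i j /in_HS; exact: mX.
Qed.

(** The k-th query of [simulated y] reads only [y k], so a constant sequence will do. *)
Definition sim_query k (Fz : {ffun Hidx k.-1 -> 'cV[R]_d} * 'cV[R]_d) : 'cV[R]_d :=
  @simulated (fun=> Fz.2) k (reconstruct Fz.1).

(** In column [k] the step reads only the entry with exponent 0, the query itself; this value
    therefore fills the whole column. *)
Definition sim_rotation k (Fz : {ffun Hidx k.-1 -> 'cV[R]_d} * 'cV[R]_d) :
    'M[R]_d :=
  rotation_step v k.-1 (fun i j => if j == k then sim_query Fz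
                        else reconstruct_table k.-1 (entries Fz.1) i j).

Lemma measurable_sim_query k : (1 <= k <= K)%N ->
  measurable_fun setT (@sim_query k).
Proof.
case: k => [//|k] kK.
apply: (@measurable_simulated _ _
  (fun Fz : {ffun Hidx k -> 'cV[R]_d} * 'cV[R]_d => fun=> Fz.2) k
  (fun Fz => reconstruct Fz.1) kK measurable_snd).
exact: (measurableT_comp (@measurable_reconstruct k) measurable_fst).
Qed.

Lemma measurable_sim_rotation k : (1 <= k <= K)%N ->
  measurable_fun setT (@sim_rotation k).
Proof.
case: k => [//|k] kK; apply: measurable_rotation_step => // i j _.
case: (j == k.+1); first exact: measurable_sim_query.
by apply: measurable_reconstruct_table => i' j'; exact: measurable_entries.
Qed.

End simulated_queries.

(** * Almost sure nondegeneracy *)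

(** If c_k is nonzero and the other coordinates are frozen, the equation forces x_k to a single
    value, and the normal law, dominated by Lebesgue measure, has no atoms. *)
Lemma gaussian_hyperplane (R : realType) d (mu : probability 'cV[R]_d R)
    (c : 'cV[R]_d) : standard_gaussian mu -> c != 0 ->
  mu [set x | dotv c x = 0] = 0%E.
Proof.
move=> gmu c0; have [k ck] : exists k, c k 0 != 0.
  apply/existsP; apply: contraNT c0; rewrite negb_exists => /forallP ck.
  apply/eqP/matrixP => i j; rewrite ord1 mxE.
  by have := ck i; rewrite negbK => /eqP.
pose X (i : 'I_d) (x : 'cV[R]_d) := x i 0.
have mX i : measurable_fun setT (X i).
  exact: (@measurable_entry _ _ _ R _ _ id).
have law1 i A : measurable A ->
    mu (X i @^-1` A) = (fine (normal_prob (0 : R) 1 A))%:E.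
  move=> mA; pose A' j := if j == i then A else setT.
  rewrite (_ : X i @^-1` A = [set x | forall j, A' j (x j 0)]); last first.
    apply/seteqP; split => x /=; last by move=> /(_ i); rewrite /A' eqxx.
    by move=> Ax j; rewrite /A'; case: eqP => // ->.
  rewrite gmu; last by move=> j; rewrite /A'; case: ifP.
  rewrite (bigD1 i)//= /A' eqxx big1 ?mulr1// => j /negbTE ->.
  by rewrite probability_setT.
have indX : mutually_independent mu X.
  move=> A mA; rewrite (_ : \bigcap_i (X i @^-1` A i) = [set x | forall i, A i (x i 0)]).
    by rewrite gmu//; congr (_%:E); apply: eq_bigr => i _; rewrite law1.
  by apply/seteqP; split => x Ax i; [exact: Ax|move=> _; exact: Ax].
pose N := [set f : {ffun 'I_d -> R} | \sum_i c i 0 * f i = 0].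
have mN : measurable N.
  apply: (@measurable_pred _ _ _ _ (fun f : {ffun 'I_d -> R} =>
    \sum_i c i 0 * f i) [set 0]) => //.
  apply: measurable_sum => i; apply: measurable_funM => //.
  exact: (@measurable_ffun_app _ _ _ R _ id).
have -> : [set x | dotv c x = 0] = [set x | N [ffun i => X i x]].
  have NE x : \sum_i c i 0 * [ffun i => X i x] i = dotv c x.
    by apply: eq_bigr => i _; rewrite ffunE.
  by apply/seteqP; split => x; rewrite /N /= NE.
apply: (null_update mX indX (k := k) mN) => f.
pose a := - (\sum_(i | i != k) c i 0 * f i) / c k 0.
have -> : [set x | N (update k f (X k x))] = X k @^-1` [set a].
  have E x : \sum_i c i 0 * update k f (X k x) i =
      c k 0 * X k x + \sum_(i | i != k) c i 0 * f i.
    rewrite (bigD1 k)//= ffunE eqxx; congr (_ + _); apply: eq_bigr => i ik.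
    by rewrite ffunE (negbTE ik).
  apply/seteqP; split => x /=; rewrite /N /= E.
    by move/eqP; rewrite addr_eq0 => /eqP ckx; rewrite /a -ckx mulrAC divff ?mul1r.
  by move=> ->; rewrite /a mulrC divfK// addrC subrr.
rewrite law1//; have /null_content_dominatesP dom :=
  normal_prob_dominates (0 : R) 1.
by rewrite dom//= lebesgue_measure_set1.
Qed.

(** Fewer than d vectors admit a nonzero c orthogonal to all of them. Then <c, z> = <c, residual of
    z>, so a vanishing residual puts z in the hyperplane orthogonal to c. *)
Lemma gaussian_residual (R : realType) d (mu : probability 'cV[R]_d R)
    (s : seq 'cV[R]_d) : standard_gaussian mu -> (size s < d)%N ->
  mu [set z | dotv (residual s z) (residual s z) = 0] = 0%E.
Proof.
move=> gmu /exists_orthogonal[c c0 cs]; apply/eqP; rewrite eq_le measure_ge0 andbT.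
rewrite -(gaussian_hyperplane gmu c0); apply: le_measure; rewrite ?inE.
- apply: (@measurable_pred _ _ _ _ (fun z => dotv (residual s z) (residual s z)) [set 0]) => //.
  suff ms : measurable_fun setT (residual s) by exact: measurable_dotv.
  have -> : residual s = fun z => residual [seq cst x z | x <- s] z.
    by apply/funext => z; rewrite map_id.
  by apply: (measurable_residual _ (f := fun x => cst x)).
- apply: (@measurable_pred _ _ _ _ (fun z => dotv c z) [set 0]) => //.
  by apply: measurable_dotv => //; exact: measurable_cst.
- move=> z /= /eqP; rewrite dotv_eq0 => /eqP r0.
  by rewrite -(dotv_residual z cs) r0 dotv0.
Qed.

(** A crude bound, but for m < K it stays below d, as K^2 < d. *)
Lemma card_Hidx m : (#|Hidx m| <= m.+1 ^ 2)%N.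
Proof.
rewrite card_sig (leq_trans (max_card _))// card_prod card_ord.
by rewrite expnS expn1.
Qed.

(** * Simulated queries and rotations under nonvanishing residuals *)

Section simulation.
Context (R : realType) (d K : nat) (v : algorithm R d).
Variables (x y : nat -> 'cV[R]_d) (L : 'M[R]_d).
Hypotheses (nd : nonvanishing_residuals v K y L)
  (xy : forall j, (1 <= j <= K)%N -> x j = y j).

Let nd_le k : (k <= K)%N -> nonvanishing_residuals v k y L.
Proof. by move=> kK m mk; apply: nd; exact: leq_trans kK. Qed.

Let xy_le k : (k <= K)%N -> forall j, (1 <= j <= k)%N -> x j = y j.
Proof. by move=> kK j jk; apply: xy; lia. Qed.

Lemma sim_queryE k : (1 <= k <= K)%N ->
  @sim_query _ _ v k (powers k.-1 L x, x k) = alg_query (simulated v y) L k.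
Proof.
case: k => [//|k] kK; rewrite /sim_query /= alg_queryE.
rewrite (reconstructE (nd_le (ltnW kK)) (xy_le (ltnW kK))).
by rewrite /simulated /= xy.
Qed.

Lemma sim_rotationE k : (1 <= k <= K)%N ->
  @sim_rotation _ _ v k (powers k.-1 L x, x k) =
  rotation_step v k.-1 (query_table (simulated v y) L).
Proof.
move=> kK; rewrite /sim_rotation sim_queryE//.
case: k kK => [//|k] kK; rewrite [k.+1.-1]/=.
set X := fun i j => if j == k.+1 then _ else _.
have XE i j : in_H k i j -> X i j = query_table (simulated v y) L i j.
  move=> ij; have jk : (j < k.+1)%N by case/and3P: ij.
  rewrite /X (ltn_eqF jk) /=.
  apply: (reconstruct_tableE (leqnn k) _ (nd_le (ltnW kK))) => // i' j' ij'.
  by rewrite entries_powers// (xy_le (ltnW kK))//; case/andP: ij'.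
rewrite /rotation_step (eq_rotation v XE).
have -> Q : table_slice k Q X = table_slice k Q (query_table (simulated v y) L).
  by apply/ffunP => p; rewrite !ffunE XE// in_H_val.
suff -> : X 0%N k.+1 = query_table (simulated v y) L 0%N k.+1 by [].
by rewrite /X eqxx /query_table expr0 mul1mx.
Qed.

Lemma prod_sim_rotation n : (n <= K)%N ->
  \prod_(1 <= k < n.+1) @sim_rotation _ _ v k (powers k.-1 L x, x k) =
  rotation v n (query_table (simulated v y) L).
Proof.
elim: n => [_|n IHn nK]; first by rewrite big_nil.
by rewrite big_nat_recr//= IHn ?(ltnW nK)// (@sim_rotationE n.+1).
Qed.

End simulation.

(** * The coupled history and the degenerate event *)

Section conclusion.
Context (R : realType) (d K : nat) (v : algorithm R d).
Hypotheses (Kd : (K ^ 2 < d)%N) (mv : measurable_algorithm K v)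
  (ov : orthonormal_queries K v).

(** Renumbers the family from 1, as the queries are; beyond [K] the value is 0, and index 0 is never
    read. *)
Definition gaussians (zeta : {ffun 'I_K -> 'cV[R]_d}) (k : nat) : 'cV[R]_d :=
  if insub k.-1 is Some o then zeta o else 0.

Lemma measurable_gaussians d1 (aT : measurableType d1)
    (zeta : aT -> {ffun 'I_K -> 'cV[R]_d}) k :
  measurable_fun setT zeta -> measurable_fun setT (fun t => gaussians (zeta t) k).
Proof.
move=> mz; rewrite /gaussians; case: (insub _) => [q|].
  exact: measurable_ffun_app.
exact: measurable_cst.
Qed.

(** The simulated history as a function of the Gaussian values and of the matrix, so that the two
    can be integrated separately. *)
Definition coupled zeta L : {ffun Hidx K -> 'cV[R]_d} :=
  let w := simulated v (gaussians zeta) in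
  [ffun p : Hidx K => (rotation v K (query_table w L))^T *m
                        powers K L (alg_query w L) p].

Let mw d1 (aT : measurableType d1) (zeta : aT -> {ffun 'I_K -> 'cV[R]_d}) :
  measurable_fun setT zeta -> forall k, (k < K)%N ->
  forall F : aT -> {ffun Hidx k -> 'cV[R]_d}, measurable_fun setT F ->
  measurable_fun setT (fun t => @simulated _ _ v (gaussians (zeta t)) k.+1 (F t)).
Proof.
move=> mz k kK F mF; apply: (measurable_simulated mv) => //.
exact: measurable_gaussians.
Qed.

Lemma measurable_coupled d1 (aT : measurableType d1)
    (zeta : aT -> {ffun 'I_K -> 'cV[R]_d}) L :
  measurable_fun setT zeta -> measurable_fun setT L ->
  measurable_fun setT (fun t => coupled (zeta t) (L t)).
Proof.
move=> mz mL; apply: measurable_ffun => p; under eq_fun do rewrite ffunE.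
apply: measurable_mulmx; last first.
  by apply: measurable_ffun_app; exact: (measurable_history mL (mw mz)).
apply/measurable_trmx/(measurable_rotation mv) => // i j ij.
apply: measurable_mulmx; first exact: measurable_expmx.
by apply: (measurable_alg_query mL (mw mz)); case/andP: ij.
Qed.

Definition degenerate m zeta L : Prop :=
  let r := residual [seq powers m L (alg_query (simulated v (gaussians zeta)) L) p
                    | p <- enum (Hidx m)] (gaussians zeta m.+1) in dotv r r = 0.

Lemma measurable_degenerate m d1 (aT : measurableType d1)
    (zeta : aT -> {ffun 'I_K -> 'cV[R]_d}) L : (m < K)%N ->
  measurable_fun setT zeta -> measurable_fun setT L ->
  measurable [set t | degenerate m (zeta t) (L t)].
Proof.
move=> mK mz mL.
pose r t := residual [seq powers m (L t)
    (alg_query (simulated v (gaussians (zeta t))) (L t)) p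
  | p <- enum (Hidx m)] (gaussians (zeta t) m.+1).
apply: (@measurable_pred _ _ _ _ (fun t => dotv (r t) (r t)) [set 0]) => //.
have mr : measurable_fun setT r.
  apply: (measurable_residual _ (f := fun p t => powers m (L t)
    (alg_query (simulated v (gaussians (zeta t))) (L t)) p)) => [p|].
    by apply: measurable_ffun_app; apply: (measurable_history mL (mw mz)); exact: ltnW.
  exact: measurable_gaussians.
exact: measurable_dotv.
Qed.

Lemma gaussiansE zeta (i : 'I_K) : gaussians zeta i.+1 = zeta i.
Proof. by rewrite /gaussians /= (valK i). Qed.

(** With the matrix and all Gaussian vectors but z_(m+1) frozen, the history of length m is a fixed
    list of fewer than d vectors. *)
Lemma degenerate_null disp (Om : measurableType disp) (P : probability Om R)
    (Z : 'I_K -> Om -> 'cV[R]_d) (mZ : forall i, measurable_fun setT (Z i)) m L :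
  (m < K)%N -> (forall i, standard_gaussian (law P (mZ i))) ->
  mutually_independent P Z ->
  P [set t | degenerate m [ffun i => Z i t] L] = 0%E.
Proof.
move=> mK gZ indZ; pose k := Ordinal mK.
apply: (null_update mZ indZ (k := k) (N := [set zeta | degenerate m zeta L])).
  by apply: measurable_degenerate => //; exact: measurable_cst.
move=> x; pose s := [seq powers m L
  (alg_query (simulated v (gaussians x)) L) p | p <- enum (Hidx m)].
rewrite -(gaussian_residual (s := s) (gZ k)).
  rewrite [RHS]lawE; congr (P _); apply/funext => t.
  rewrite /preimage /mkset/= /degenerate.
  have -> : gaussians (update k x (Z k t)) m.+1 = Z k t.
    by rewrite -[m]/(nat_of_ord k) gaussiansE ffunE eqxx.
  (* The history of length m reads only z_1, ..., z_m, while the update changes z_(m+1), stored at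
     ordinal m. *)
  have -> : powers m L (alg_query (simulated v (gaussians (update k x (Z k t)))) L) =
            powers m L (alg_query (simulated v (gaussians x)) L).
    apply/eq_powers => i j /and3P[_ j0 jm]; congr (_ *m _).
    apply: (@eq_simulated _ _ _ _ _ _ m) => // -[//|l] /= lm.
    have lK : (l < K)%N by lia.
    rewrite -[l]/(nat_of_ord (Ordinal lK)) !gaussiansE ffunE.
    by case: eqP => // /(congr1 val) /= lE; lia.
  by [].
rewrite size_map -cardE (leq_ltn_trans (card_Hidx m))// (leq_ltn_trans _ Kd)//.
by rewrite leq_exp2r.
Qed.

End conclusion.

(** * Conjugation invariance of the random matrix and the simulation theorem *)

Lemma measure_eq_negligible disp (T : measurableType disp) (R : realType)
    (P : probability T R) (A B N : set T) : measurable A -> measurable B ->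
  P.-negligible N -> (forall t, ~ N t -> A t <-> B t) -> P A = P B.
Proof.
move=> mA mB [N' [mN' PN' NN']] AB.
have PD C : measurable C -> P C = P (C `\` N').
  move=> mC; rewrite (measureDI _ mC mN') [X in (_ + X)%E](_ : _ = 0%E) ?adde0//.
  by apply: (subset_measure0 _ mN' (@subIsetr _ _ _)) => //; exact: measurableI.
rewrite PD// [RHS]PD//; congr (P _); apply/seteqP.
by split => t [At N't]; split => //; apply/AB => // /NN'.
Qed.

(** Conjugating U^T D U by Q replaces U by U Q; for fixed D, right invariance of Haar measure
    applies. *)
Lemma conjugation_invariant_law disp (Om : measurableType disp) (R : realType)
    (P : probability Om R) d (U : {RV P >-> 'M[R]_d}) (D : {RV P >-> 'rV[R]_d})
    (mL : measurable_fun setT (fun t => (U t)^T *m diag_mx (D t) *m U t)) :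
  haar_orthogonal (distribution P U) -> independent P U D ->
  forall Q A, orthogonal_mx Q -> measurable A ->
  law P mL [set L | A (conjugate Q L)] = law P mL A.
Proof.
move=> [_ haarM] UD Q A oQ mA.
have mU : measurable_fun setT U by exact: measurable_funPT.
have mD : measurable_fun setT D by exact: measurable_funPT.
have DU : independent P D U.
  by move=> B C mB mC; rewrite setIC UD// muleC.
pose f (S : 'M[R]_d) (x : 'rV[R]_d * 'M[R]_d) :=
  conjugate (x.2 *m S) (diag_mx x.1).
have mf S : measurable_fun setT (f S).
  apply: measurable_conjugate; last by apply: measurable_diag_mx.
  by apply: measurable_mulmx => //; exact: measurable_cst.
have mfA S : measurable [set x | A (f S x)] by exact: measurable_pred.
have lawf S : P [set t | A (conjugate S ((U t)^T *m diag_mx (D t) *m U t))] =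
    (law P mD \x law P mU)%E [set x | A (f S x)].
  rewrite -(law_pair mD mU DU (mfA S)); congr (P _).
  by apply/funext => t; rewrite /mkset /f conjugateM.
rewrite [LHS](lawf Q); transitivity
    ((law P mD \x law P mU)%E [set x | A (f 1%:M x)]); last first.
  rewrite -lawf [RHS]lawE; congr (P _).
  by apply/funext => t; rewrite /mkset /preimage conjugate1.
apply: (product_measure_eqx (mfA Q) (mfA 1%:M) measurableT).
  exact: probability_setT.
move=> D0 _; pose B := [set V : 'M[R]_d | A (f 1%:M (D0, V))].
have mB : measurable B.
  apply: (measurable_pred (f := fun V : 'M[R]_d => f 1%:M (D0, V))) => //.
  by apply: (measurableT_comp (mf 1%:M)); exact: measurable_fun_pair.
have [_ E] := haarM Q B oQ mB; rewrite -[RHS]E; congr (P _).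
by apply/funext => t; rewrite /preimage /mkset /B /f /= mulmx1.
Qed.

Theorem lemma39 (R : realType) (d K : nat) (v : algorithm R d)
    (Kd : (K ^ 2 < d)%N)
    (v_meas : measurable_algorithm K v)
    (v_orth : orthonormal_queries K v) :
  exists (vt : forall k : nat,
                 {ffun Hidx k.-1 -> 'cV[R]_d} * 'cV[R]_d -> 'cV[R]_d)
         (Us : forall k : nat,
                 {ffun Hidx k.-1 -> 'cV[R]_d} * 'cV[R]_d -> 'M[R]_d)
         (G : {ffun Hidx K -> 'cV[R]_d} -> {ffun Hidx K -> 'cV[R]_d}),
    (forall k : nat, (1 <= k <= K)%N ->
       measurable_fun setT (vt k) /\ measurable_fun setT (Us k)) /\
    measurable_fun setT G /\
    forall (disp : measure_display) (Om : measurableType disp)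
      (P : probability Om R)
      (U : {RV P >-> 'M[R]_d}) (D : {RV P >-> 'rV[R]_d})
      (z : nat -> {RV P >-> 'cV[R]_d}),
      let Lam := fun w : Om => (U w)^T *m diag_mx (D w) *m U w in
      let zs := fun (w : Om) (j : nat) => z j w in
      let data := fun (w : Om) (k : nat) =>
        (powers k.-1 (Lam w) (zs w), zs w k) in
      let vsim := fun (w : Om) (k : nat) => vt k (data w k) in
      let Usim := fun (w : Om) (k : nat) => Us k (data w k) in
      let Uprod := fun w : Om => \prod_(1 <= k < K.+1) Usim w k in
      haar_orthogonal (distribution P U) ->
      independent P U D ->
      (forall k : nat, (1 <= k <= K)%N ->
         standard_gaussian (distribution P (z k))) ->
      mutually_independent P (fun (j : 'I_K) (w : Om) => zs w j.+1) ->
      independent P (fun w : Om => [ffun j : 'I_K => zs w j.+1]) Lam ->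
      {ae P, forall w, forall k : nat, (1 <= k <= K)%N ->
         unit_vector (vsim w k) /\ orthogonal_mx (Usim w k)} /\
      eq_in_law P
        (fun w => [ffun p : Hidx K =>
                     (Uprod w)^T *m powers K (Lam w) (vsim w) p])
        (fun w => powers K (Lam w) (alg_query v (Lam w))) /\
      {ae P, forall w,
         powers K (Lam w) (vsim w) = G (powers K (Lam w) (zs w))}.
Proof.
exists (@sim_query R d v), (@sim_rotation R d v), (@reconstruct R d K).
split; first by move=> k kK; split;
  [exact: (measurable_sim_query v_meas)|exact: (measurable_sim_rotation v_meas)].
split; first exact: measurable_reconstruct.
move=> disp Om P U D z Lam zs data vsim Usim Uprod haarU UD gz indz zLam.
have mU : measurable_fun setT U by exact: measurable_funPT.
have mD : measurable_fun setT D by exact: measurable_funPT.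
have mz j : measurable_fun setT (z j) by exact: measurable_funPT.
have mLam : measurable_fun setT Lam.
  by apply: measurable_mulmx => //; apply: measurable_mulmx;
    [exact: measurable_trmx|exact: measurable_diag_mx].
pose zeta w : {ffun 'I_K -> 'cV[R]_d} := [ffun j : 'I_K => zs w j.+1].
have mzeta : measurable_fun setT zeta.
  by apply: measurable_ffun => j; under eq_fun do rewrite ffunE; exact: mz.
pose y w := gaussians (zeta w).
have zy w j : (1 <= j <= K)%N -> zs w j = y w j.
  case: j => [//|j] jK; rewrite /y -[j]/(nat_of_ord (Ordinal jK)) gaussiansE.
  by rewrite ffunE.
pose good w := nonvanishing_residuals v K (y w) (Lam w).
have bad_null : P.-negligible [set w | ~ good w].
  have degP : P.-negligible
      (\bigcup_m [set w | (m < K)%N /\ degenerate v m (zeta w) (Lam w)]).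
    apply: negligible_bigcup => m; have [mK|mK] := ltnP m K; last first.
      by apply: negligibleS (@negligible_set0 _ _ _ P) => w [].
    have mdeg := @measurable_degenerate R d K v v_meas m _ _ _ _ mK.
    apply: (@negligibleS _ _ _ _ [set w | degenerate v m (zeta w) (Lam w)]).
      by move=> w [].
    apply/negligibleP; first exact: mdeg.
    have mE := mdeg _ _ _ _ measurable_fst measurable_snd.
    (* By independence the matrix can be frozen, and the Gaussian vectors alone make the event
       null. *)
    rewrite [LHS](law_pair mzeta mLam zLam mE).
    apply: (product_measure_csty mE measurableT); first exact: probability_setT.
    move=> L _; exact: (@degenerate_null _ _ K v Kd v_meas _ _ P  (fun (j : 'I_K) w => zs w j.+1) (fun j => mz j.+1) m L mK (fun i => gz i.+1 (ltn_ord i)) indz).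
  apply: negligibleS degP => w /= ngood; apply: contrapT => nbad; apply: ngood.
  move=> m mK /=; apply/eqP => r0; apply: nbad; exists m => //.
have simE w : good w -> forall k, (1 <= k <= K)%N ->
    vsim w k = alg_query (simulated v (y w)) (Lam w) k.
  by move=> gw k kK; exact: (sim_queryE gw (zy w)).
have powersE w : good w -> powers K (Lam w) (vsim w) =
    powers K (Lam w) (alg_query (simulated v (y w)) (Lam w)).
  by move=> gw; apply/eq_powers => i j /andP[_ jK]; rewrite simE.
have mvsim k : (1 <= k <= K)%N -> measurable_fun setT (fun w => vsim w k).
  move=> kK; apply: (measurableT_comp (measurable_sim_query v_meas kK)).
  by apply: measurable_fun_pair => //; exact: measurable_powers.
have mUsim k : (1 <= k <= K)%N -> measurable_fun setT (fun w => Usim w k).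
  move=> kK; apply: (measurableT_comp (measurable_sim_rotation v_meas kK)).
  by apply: measurable_fun_pair => //; exact: measurable_powers.
have mUprod : measurable_fun setT Uprod.
  suff mprod n : (n <= K)%N ->
      measurable_fun setT (fun w => \prod_(1 <= k < n.+1) Usim w k) by exact: mprod.
  elim: n => [_|n IHn nK].
    by under eq_fun do rewrite big_nil; exact: measurable_cst.
  under eq_fun do rewrite big_nat_recr//=.
  by apply: measurable_mulmx; [exact/IHn/ltnW|exact: mUsim].
split.
  (* This part holds for every outcome, thanks to the fallback of [simulated] on the query of
     [v]. *)
  apply: aeW => w k kK; split.
    by have [] := orthonormal_simulated v_orth (fun=> zs w k) kK
      (reconstruct (powers k.-1 (Lam w) (zs w))).
  exact: orthogonal_reflection.
split; last first.
  apply: negligibleS bad_null => w /= nG gw; apply: nG.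
  by rewrite powersE// (reconstructE gw (zy w)).
move=> A mA.
have mcoupled : measurable_fun setT (fun w => coupled v (zeta w) (Lam w)).
  exact: measurable_coupled.
(* Outside the null event the simulated data are those of the coupled run. *)
transitivity (P [set w | A (coupled v (zeta w) (Lam w))]).
  apply: (measure_eq_negligible _ _ bad_null).
  - apply: (measurable_pred _ mA); apply: measurable_ffun => p.
    under eq_fun do rewrite ffunE.
    apply: measurable_mulmx; first exact: measurable_trmx.
    by apply: measurable_ffun_app; exact: measurable_powers.
  - exact: (measurable_pred mcoupled mA).
  - move=> w /contrapT gw; rewrite /preimage /mkset /coupled.
    by rewrite /Uprod (prod_sim_rotation gw (zy w) (leqnn K)) powersE.
have mE : measurable [set x | A (coupled (K := K) v x.1 x.2)].
  apply: (measurable_pred _ mA); exact: measurable_coupled.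
rewrite [LHS](law_pair mzeta mLam zLam mE).
(* For each fixed value of the Gaussian vectors the coupled history has the law of the history of
   [v], which does not involve that value. *)
apply: (product_measure_cstx mE measurableT); first exact: probability_setT.
move=> x _.
exact: (coupled_law v_meas (measurable_algorithm_simulated v_meas (gaussians x))
  v_orth (orthonormal_simulated v_orth (gaussians x)) haarU
  (conjugation_invariant_law mLam haarU UD) mA).
Qed.
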